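(* For every fixed $d\in\mathbb N$, $$\lim_{n\to\infty}\frac{\boldsymbol\lambda\bigl(\mathcal P_d(\ell_\infty^n(\mathbb C))\bigr)}{\sqrt{\binom{n+d-1}{d}}}=\frac{\Gamma\bigl(1+\frac d2\bigr)}{\sqrt{d!}}.$$ Equivalently, $$\lim_{n\to\infty}\frac{\boldsymbol\lambda\bigl(\mathcal P_d(\ell_\infty^n(\mathbb C))\bigr)}{n^{d/2}}=\frac{\Gamma\bigl(1+\frac d2\bigr)}{d!}.$$
   Context: $\ell_\infty^n(\mathbb C)=(\mathbb C^n,\|\cdot\|_\infty)$. $\mathcal P_d(\ell_\infty^n(\mathbb C))$ is the complex Banach space of all $d$-homogeneous polynomials $P(z)=\sum_{\alpha\in\mathbb N_0^n,|\alpha|=d}c_\alpha z^\alpha$ ($c_\alpha\in\mathbb C$) on $\mathbb C^n$ with norm $\|P\|=\sup_{\|z\|_\infty\le1}|P(z)|$. Projection constants: for a subspace $X$ of a Banach space $Y$, $\boldsymbol\lambda(X,Y)=\inf\{\|P\|: P\in\mathcal L(Y),\ P^2=P,\ P(Y)=X\}$; $\boldsymbol\lambda(X)=\sup_Y\boldsymbol\lambda(X,Y)$ over all Banach spaces $Y$ containing $X$ isometrically. *)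

(* Defs.v *)
From HB Require Import structures.
From mathcomp Require Import all_boot all_order all_algebra.
From mathcomp Require Import complex.
From mathcomp Require Import all_classical all_reals all_analysis.
From mathcomp.multinomials Require Import -(notations) mpoly.

Set Implicit Arguments.
Unset Strict Implicit.
Unset Printing Implicit Defensive.

Import Order.TTheory GRing.Theory Num.Theory.
Import numFieldNormedType.Exports.

Local Open Scope classical_set_scope.
Local Open Scope ring_scope.

(* The norm of a normed space over [R[i]] takes its values in [R[i]] (they are
   nonnegative, hence real); [rnorm] is the same norm seen in [R]. *)
Definition rnorm (R : realType) (V : normedZmodType R[i]) (x : V) : R :=
  complex.Re `|x|.

Lemma rnormE (R : realType) (V : normedZmodType R[i]) (x : V) :
  (rnorm x)%:C%C = `|x|.
Proof.
rewrite /rnorm; have := normr_ge0 x.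
by case: (`|x|) => a b; rewrite lecE /= => /andP[/eqP -> _].
Qed.

Lemma rnorm_ge0 (R : realType) (V : normedZmodType R[i]) (x : V) :
  0 <= rnorm x.
Proof. by rewrite -lecR rnormE normr_ge0. Qed.

Lemma le_rnorm (R : realType) (V : normedZmodType R[i]) (x : V) (r : R) :
  (rnorm x <= r) = (`|x| <= r%:C%C).
Proof. by rewrite -lecR rnormE. Qed.

Lemma kronecker_inj (B n : nat) (f g : 'I_n -> nat) :
  (forall i, f i < B)%N -> (forall i, g i < B)%N ->
  (\sum_i f i * B ^ i = \sum_i g i * B ^ i)%N -> f =1 g.
Proof.
elim: n f g => [f g _ _ _ [] //|n IHn] f g fB gB.
have B0 : (0 < B)%N by exact: leq_ltn_trans (fB ord0).
have split h : (\sum_(i < n.+1) h i * B ^ i =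
    (\sum_(i < n) h (lift ord0 i) * B ^ i) * B + h ord0)%N.
  rewrite big_ord_recl expn0 muln1 addnC big_distrl /=; congr addn.
  by apply: eq_bigr => i _; rewrite /bump add1n expnSr mulnA.
rewrite !split => E.
have E0 : f ord0 = g ord0.
  by have := congr1 (modn^~ B) E; rewrite !modnMDl !modn_small.
have E1 : (fun i => f (lift ord0 i)) =1 (fun i => g (lift ord0 i)).
  apply: IHn => // /=; apply/eqP; rewrite -(eqn_pmul2r B0).
  by rewrite -(eqn_add2r (f ord0)) {2}E0; apply/eqP.
by move=> i; case: (unliftP ord0 i) => [j ->|->].
Qed.

Lemma mpoly_eq0_on_ball (K : numFieldType) (n : nat) (p : mpoly n K) :
  (forall v : 'I_n -> K, (forall i, `|v i| <= 1) -> meval v p = 0) -> p = 0.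
Proof.
move=> p0; pose B := (msize p).+1.
pose e (m : multinom n) := (\sum_i m i * B ^ i)%N.
pose q : {poly K} := \sum_(m <- msupp p) mcoeff m p *: 'X^(e m).
have q0 : q = 0.
  pose s := [seq (k.+1%:R : K)^-1 | k <- iota 0 (size q)].
  apply: (@roots_geq_poly_eq0 _ _ s); last by rewrite size_map size_iota.
  - apply/allP => _ /mapP[k _ ->]; set t := _^-1; apply/rootP.
    have t1 : `|t| <= 1.
      rewrite normfV ger0_norm ?ler0n// invf_le1 ?ltr0n//.
      by rewrite ler1n.
    rewrite -(p0 (fun i => t ^+ (B ^ i)%N)); last first.
      by move=> i; rewrite normrX exprn_ile1.
    rewrite mevalE horner_sum; apply: eq_bigr => m _.
    rewrite hornerZ hornerXn; congr (_ * _).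
    rewrite /e -prodrXr; apply: eq_bigr => i _.
    by rewrite -exprM mulnC.
  - rewrite map_inj_uniq ?iota_uniq// => i j /invr_inj/eqP.
    by rewrite eqr_nat eqSS => /eqP.
apply/mpolyP => m; rewrite mcoeff0; apply/eqP/contraT => mp.
have mS : m \in msupp p by rewrite mcoeff_msupp.
have : q`_(e m) = 0 by rewrite q0 coef0.
rewrite coef_sum (bigD1_seq m) ?msupp_uniq//= coefZ coefXn eqxx mulr1.
rewrite big_seq_cond big1 ?addr0; first by move/eqP; rewrite (negPf mp).
move=> m' /andP[m'S m'm]; rewrite coefZ coefXn.
case: eqP => [E|]; last by rewrite mulr0.
have lt u : u \in msupp p -> forall i, (u i < B)%N.
  move=> uS i; apply: (@leq_ltn_trans (mdeg u)).
    by rewrite mdegE (bigD1 i) //= leq_addr.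
  by apply: leqW; apply: msize_mdeg_lt.
case/eqP: m'm; apply/mnmP => i; symmetry.
exact: (kronecker_inj (lt _ mS) (lt _ m'S) E).
Qed.

(* [dhomog n R[i] d] is the space of formal [d]-homogeneous polynomials in [n]
   variables; a polynomial and its function on C^n determine each other, by
   [mpoly_eq0_on_ball].  The alias carries the sup norm over the unit ball of
   l_oo^n(C), which is ['rV[R[i]]_n] with its library norm. *)
Definition homog_poly (R : realType) (n d : nat) : Type := dhomog n R[i] d.

HB.instance Definition _ (R : realType) (n d : nat) :=
  GRing.Lmodule.copy (homog_poly R n d) (dhomog n R[i] d).

Definition homog_poly_eval (R : realType) (n d : nat) (p : homog_poly R n d)
  (z : 'rV[R[i]]_n) : R[i] := meval (z ord0) (mpoly_of_dhomog p).

Definition homog_poly_norm (R : realType) (n d : nat) (p : homog_poly R n d) : R :=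
  sup [set rnorm (homog_poly_eval p z) | z in [set z | `|z| <= 1]].

Section HomogPolyNorm.
Variables (R : realType) (n d : nat).
Implicit Types (p q : homog_poly R n d) (z : 'rV[R[i]]_n).

Lemma coord_le_norm z i : `|z ord0 i| <= `|z|.
Proof.
rewrite [`|z|]mx_normE; set m := (X in _ <= X%:num).
have : m <= m by [].
by move=> /bigmax_leP[_ /(_ (ord0, i) isT)]; rewrite -num_le.
Qed.

Lemma homog_poly_evalD p q z :
  homog_poly_eval (p + q) z = homog_poly_eval p z + homog_poly_eval q z.
Proof. exact: mevalD. Qed.

Lemma homog_poly_evalZ c p z :
  homog_poly_eval (c *: p) z = c * homog_poly_eval p z.
Proof. exact: mevalZ. Qed.

Lemma homog_poly_has_sup p :
  has_sup [set rnorm (homog_poly_eval p z) | z in [set z | `|z| <= 1]].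
Proof.
split; first by exists (rnorm (homog_poly_eval p 0)); exists 0; rewrite //= normr0.
exists (\sum_(m <- msupp (mpoly_of_dhomog p)) rnorm (mcoeff m (mpoly_of_dhomog p))).
move=> _ [z /= z1 <-]; rewrite le_rnorm /homog_poly_eval mevalE.
apply: (le_trans (ler_norm_sum _ _ _)).
rewrite rmorph_sum /=; apply: ler_sum => m _.
rewrite rnormE normrM ler_piMr// normr_prod.
apply: prodr_ile1 => i _; rewrite normr_ge0 normrX exprn_ile1//.
exact: le_trans (coord_le_norm _ _) z1.
Qed.

Lemma homog_poly_norm_ub p z : `|z| <= 1 ->
  rnorm (homog_poly_eval p z) <= homog_poly_norm p.
Proof.
by move=> z1; apply: ub_le_sup; [exact: (homog_poly_has_sup p).2 | exists z].
Qed.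

Lemma homog_poly_norm_le p r :
  (forall z, `|z| <= 1 -> rnorm (homog_poly_eval p z) <= r) ->
  homog_poly_norm p <= r.
Proof.
move=> pr; apply: ge_sup; first exact: (homog_poly_has_sup p).1.
by move=> _ [z z1 <-]; exact: pr.
Qed.

Lemma homog_poly_norm_ge0 p : 0 <= homog_poly_norm p.
Proof.
by apply: le_trans (rnorm_ge0 _) (homog_poly_norm_ub p (z := 0) _); rewrite normr0.
Qed.

Lemma homog_poly_normD p q :
  (homog_poly_norm (p + q))%:C%C <=
  (homog_poly_norm p)%:C%C + (homog_poly_norm q)%:C%C.
Proof.
rewrite -rmorphD /= lecR; apply: homog_poly_norm_le => z z1.
rewrite le_rnorm homog_poly_evalD rmorphD /= (le_trans (ler_normD _ _))//.
by rewrite lerD// -le_rnorm homog_poly_norm_ub.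
Qed.

Lemma homog_poly_normZ_le c p :
  homog_poly_norm (c *: p) <= rnorm c * homog_poly_norm p.
Proof.
apply: homog_poly_norm_le => z z1.
rewrite le_rnorm homog_poly_evalZ normrM rmorphM /= rnormE ler_wpM2l//.
by rewrite -le_rnorm homog_poly_norm_ub.
Qed.

Lemma homog_poly_normZ c p :
  (homog_poly_norm (c *: p))%:C%C = `|c| * (homog_poly_norm p)%:C%C.
Proof.
rewrite -rnormE -rmorphM /=; congr _%:C%C; apply/eqP; rewrite eq_le.
rewrite homog_poly_normZ_le /=.
have [->|c0] := eqVneq c 0.
  by rewrite /rnorm normr0 mul0r homog_poly_norm_ge0.
have c_gt0 : 0 < rnorm c by rewrite -ltcR rnormE normr_gt0.
rewrite -ler_pdivlMl//.
have := homog_poly_normZ_le c^-1 (c *: p).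
rewrite scalerA mulVf// scale1r; congr (_ <= _ * _).
by apply: (@complexI R); rewrite rnormE normfV -rnormE fmorphV.
Qed.

Lemma homog_poly_norm_eq0 p : (homog_poly_norm p)%:C%C = 0 -> p = 0.
Proof.
move=> /(@complexI R) p0; apply: val_inj; apply: mpoly_eq0_on_ball => v v1.
pose z : 'rV[R[i]]_n := \row_i v i.
have z1 : `|z| <= 1.
  rewrite -[`|z|]/(mx_norm z).
  have [->|/mx_norm_neq0[i ->]] := eqVneq (mx_norm z) 0; first exact: ler01.
  by rewrite mxE.
have := homog_poly_norm_ub p z1; rewrite p0 le_rnorm normr_le0 => /eqP <-.
by apply: meval_eq => i; rewrite mxE.
Qed.

End HomogPolyNorm.

HB.instance Definition _ (R : realType) (n d : nat) :=
  Lmodule_isNormed.Build R[i] (homog_poly R n d)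
    (@homog_poly_normD R n d) (@homog_poly_normZ R n d)
    (@homog_poly_norm_eq0 R n d).

Lemma homog_poly_normE (R : realType) (n d : nat) (p : homog_poly R n d) :
  rnorm p = homog_poly_norm p.
Proof. by []. Qed.

Definition operator_norm (R : realType) (Y : completeNormedModType R[i])
    (f : Y -> Y) : \bar R :=
  ereal_sup [set (rnorm (f y))%:E | y in [set y : Y | `|y| <= 1]].

(* Relative projection constant of a subspace A of Y; the infimum
   is +oo if there is no bounded projection of Y onto A. *)
Definition relative_projection_constant (R : realType)
    (Y : completeNormedModType R[i]) (A : set Y) : \bar R :=
  ereal_inf [set operator_norm P | P in
    [set P : {linear Y -> Y} |
      [/\ continuous P, (forall y, P (P y) = P y) & range P = A]]].

(* Absolute projection constant: supremum over all Banach spaces Y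
   and all linear isometric embeddings of X into Y. *)
Definition projection_constant (R : realType) (X : normedModType R[i]) : \bar R :=
  ereal_sup [set l | exists (Y : completeNormedModType R[i])
    (j : {linear X -> Y}),
    (forall x, `|j x| = `|x|) /\ l = relative_projection_constant (range j)].

(* Euler's integral, which defines Gamma at real [x > 0] only. *)
Definition Gamma (R : realType) (x : R) : R :=
  Rintegral lebesgue_measure `]0, +oo[ (fun t => t `^ (x - 1) * expR (- t)).

(* Main.v *)
(* Put h(z) = sum of all monomials of degree d.  Let G_N be the group of n-tuples
   of N-th roots of unity, with mean E, and write |h| for the modulus of h.

   Upper bound.  Let N > d and let X = P_d(l_oo^n) sit isometrically in Y.  By
   Hahn-Banach each evaluation at w in G_N extends from X to a norm-one functional
   on Y, and discrete Fourier inversion makes these into a projection onto X whose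
   norm is at most the supremum over u in the torus of E_w |h(u w)|.

   Lower bound.  Multiplication by (z_1 ... z_n)^M embeds X isometrically into
   Y = P_(d+nM)(l_oo^n).  Averaging a projection of Y onto X over the rotations by
   G_N, N large, turns it into the Fourier projection without increasing its norm;
   testing it on a polynomial close to (z_1 ... z_n)^M h / |h| on the torus gives
   E |h| - eps.  Such polynomials come from the polynomial iteration for sqrt.

   Asymptotics.  With S = z_1 + ... + z_n, E (S^d conj h) = n^d is the sum of the
   coefficients of S^d and E |h|^2 = C(n+d-1, d), so S^d - d! h is negligible in
   mean square.  Finally M_q = E |S|^q / n^(q/2) tends to Gamma(1 + q/2): expanding
   |S|^q around S - z_j gives M_(q+2) = (1 + q/2) M_q + O(n^(-1/2)), and log-convexity
   in q then determines the limit as in the Bohr-Mollerup theorem.  All estimates are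
   uniform in N > 2 and in a rotation u of the variables. *)
From HB Require Import structures.
Require Import Defs.
From mathcomp Require Import all_boot all_order all_algebra.
From mathcomp Require Import complex.
From mathcomp Require Import all_classical all_reals all_analysis.
From mathcomp.multinomials Require Import -(notations) mpoly.
From mathcomp Require Import measurable_realfun cyclic separable cyclotomic ring lra zify.

Set Implicit Arguments.
Unset Strict Implicit.
Unset Printing Implicit Defensive.

Import Order.TTheory GRing.Theory Num.Theory.
Import numFieldNormedType.Exports.

Local Open Scope classical_set_scope.
Local Open Scope ring_scope.

(** * Moments of sums of independent unimodular variables *)

Section Average.
Variables (R : numFieldType) (W : finType).
Definition avg (f : W -> R) : R := (\sum_w f w) / #|W|%:R.

Lemma avgD f g : avg (fun w => f w + g w) = avg f + avg g.
Proof. by rewrite /avg big_split mulrDl. Qed.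

Lemma avgZ c f : avg (fun w => c * f w) = c * avg f.
Proof. by rewrite /avg -big_distrr mulrA. Qed.

Lemma avgB f g : avg (fun w => f w - g w) = avg f - avg g.
Proof. by rewrite /avg sumrB mulrBl. Qed.

Lemma avg_sum (I : finType) (P : pred I) (F : I -> W -> R) :
  avg (fun w => \sum_(i | P i) F i w) = \sum_(i | P i) avg (F i).
Proof. by rewrite /avg exchange_big mulr_suml. Qed.

Lemma eq_avg f g : f =1 g -> avg f = avg g.
Proof. by move=> fg; rewrite /avg (eq_bigr g). Qed.

Lemma avg_le f g : (forall w, f w <= g w) -> avg f <= avg g.
Proof.
by move=> fg; rewrite /avg ler_wpM2r ?invr_ge0 ?ler0n// ler_sum.
Qed.

Lemma avg_ge0 f : (forall w, 0 <= f w) -> 0 <= avg f.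
Proof. by move=> f0; rewrite /avg divr_ge0 ?ler0n// sumr_ge0. Qed.

Lemma ler_norm_avg f : `|avg f| <= avg (fun w => `|f w|).
Proof.
rewrite /avg normrM normfV normr_nat ler_wpM2r ?invr_ge0 ?ler0n//.
exact: ler_norm_sum.
Qed.

Lemma avg_cst c : (0 < #|W|)%N -> avg (fun=> c) = c.
Proof.
move=> W0; rewrite /avg sumr_const -[c *+ _]mulr_natr mulfK//.
by rewrite pnatr_eq0 -lt0n.
Qed.
End Average.

(** At the point [(- c, a)] the form equals [a * (a * b - c ^+ 2)]. If [a = 0] and [c] is nonzero,
    it is affine in [x] and takes the value -1. The same form yields Cauchy-Schwarz for finite
    averages and log-convexity for Euler integrals. *)
Lemma nonneg_form_discriminant (R : realFieldType) (a b c : R) :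
  (forall x y, 0 <= x ^+ 2 * a + 2 * x * y * c + y ^+ 2 * b) -> c ^+ 2 <= a * b.
Proof.
move=> form_ge0; have [a0|a_neq0] := eqVneq a 0.
  have [c0|c_neq0] := eqVneq c 0; first by rewrite a0 c0 expr0n mul0r.
  have := form_ge0 (- (b + 1) / (2 * c)) 1.
  rewrite a0 (_ : _ + _ = - 1); last by field.
  by rewrite lerNr oppr0 ler10.
have a_gt0 : 0 < a.
  have := form_ge0 1 0; rewrite lt_neqAle eq_sym a_neq0 => /le_trans; apply.
  by lra.
have := form_ge0 (- c) a.
rewrite (_ : _ + _ = a * (a * b - c ^+ 2)); last by ring.
by rewrite pmulr_rge0// subr_ge0.
Qed.

Lemma avg_cauchy_schwarz (R : realFieldType) (W : finType) (f g : W -> R) :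
  (avg (fun w => f w * g w)) ^+ 2 <=
  avg (fun w => f w ^+ 2) * avg (fun w => g w ^+ 2).
Proof.
apply: nonneg_form_discriminant => x y.
rewrite -!avgZ -!avgD; apply: avg_ge0 => w.
by have := sqr_ge0 (x * f w + y * g w); lra.
Qed.

(* The only features of S = x_1 + ... + x_n (independent, uniform on a circle or
   on roots of unity of order at least 3) used by the moment computation:
   [rho = |S|], [r j = |S - x_j|], [t j = Re (conj (S - x_j) x_j)]. *)
Record unimodular_walk (R : realFieldType) (W : finType) (n : nat)
    (rho : W -> R) (r t : 'I_n -> W -> R) : Prop := UnimodularWalk {
  uw_card : (0 < #|W|)%N;
  uw_rho : forall w, 0 <= rho w;
  uw_r : forall j w, 0 <= r j w;
  uw_t : forall j w, `|t j w| <= r j w;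
  uw_dist : forall j w, `|rho w - r j w| <= 1;
  uw_sqr : forall j w, rho w ^+ 2 = r j w ^+ 2 + 2 * t j w + 1;
  uw_sum : forall w, \sum_j (1 + t j w) = rho w ^+ 2;
  uw_t0 : forall j g, avg (fun w => t j w * g (r j w)) = 0;
  uw_tt : forall j g,
    avg (fun w => (2 * t j w ^+ 2 - r j w ^+ 2) * g (r j w)) = 0 }.

(** * Elementary estimates for differences of powers *)

Section PowerInequalities.
Variable R : realFieldType.
Implicit Types (x y : R) (q : nat).

Lemma distrX_le x y q : 0 <= x -> 0 <= y -> `|x - y| <= 1 ->
  `|x ^+ q.+1 - y ^+ q.+1| <= q.+1%:R * (1 + x) ^+ q.
Proof.
move=> x0 y0 xy; have yx : y <= 1 + x by move: xy; rewrite ler_norml; lra.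
rewrite subrXX normrM -[leRHS]mul1r ler_pM//.
rewrite (le_trans (ler_norm_sum _ _ _))//.
rewrite mulr_natl -[X in _ *+ X]card_ord -sumr_const ler_sum// => i _.
rewrite normrM !normrX !ger0_norm//.
have -> : (1 + x) ^+ q = (1 + x) ^+ (q.+1.-1 - i) * (1 + x) ^+ i.
  by rewrite -exprD subnK// -ltnS.
by apply: ler_pM; rewrite ?exprn_ge0 ?subn1// lerXn2r// ?nnegrE; lra.
Qed.

(* The expansion [rho^Q = r^Q + (Q / 2) r^(Q - 2) (rho^2 - r^2) + ...] with
   Q = q + 1, multiplied by [r] so that no negative power occurs for Q = 1. *)
Lemma second_order_le (r rho : R) q : 0 <= r -> 0 <= rho -> `|rho - r| <= 1 ->
  `|r * rho ^+ q.+1 - r ^+ q.+2 - q.+1%:R / 2 * r ^+ q * (rho ^+ 2 - r ^+ 2)|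
    <= q.+1%:R ^+ 2 * (1 + rho) ^+ q.
Proof.
move=> r0 rho0 d1; elim: q => [|q IH].
  rewrite !expr0 (_ : _ - _ = - ((rho - r) ^+ 2 / 2)); last by field.
  rewrite normrN normrM normrX [`|2^-1|]ger0_norm ?invr_ge0//.
  have : `|rho - r| ^+ 2 <= 1 by rewrite exprn_ile1.
  lra.
set E := (X in `|X| <= _) in IH.
have rr : r <= 1 + rho by move: d1; rewrite ler_norml; lra.
rewrite (_ : _ - _ = r * E + (rho - r) *
   (r * (rho ^+ q.+1 - r ^+ q.+1) + (r ^+ q.+1 * ((r - rho) / 2)))); last first.
  by rewrite /E !exprS -natr1; field.
have P0 : 0 <= (1 + rho) ^+ q by rewrite exprn_ge0// addr_ge0.
have H1 : `|r * E| <= q.+1%:R ^+ 2 * (1 + rho) ^+ q.+1.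
  rewrite normrM (ger0_norm r0) [_ ^+ q.+1 in leRHS]exprS mulrCA.
  by rewrite ler_pM.
have H2 : `|r * (rho ^+ q.+1 - r ^+ q.+1)| <= q.+1%:R * (1 + rho) ^+ q.+1.
  rewrite normrM (ger0_norm r0) [_ ^+ q.+1 in leRHS]exprS mulrCA ler_pM//.
  exact: distrX_le.
have H3 : `|r ^+ q.+1 * ((r - rho) / 2)| <= 2^-1 * (1 + rho) ^+ q.+1.
  rewrite normrM mulrC normrM [`|2^-1|]ger0_norm ?invr_ge0// distrC.
  rewrite ler_pM ?mulr_ge0 ?invr_ge0//; first lra.
  by rewrite normrX (ger0_norm r0) lerXn2r// nnegrE; lra.
rewrite (le_trans (ler_normD _ _))//.
have H4 : `|(rho - r) * (r * (rho ^+ q.+1 - r ^+ q.+1) + r ^+ q.+1 * ((r - rho) / 2))|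
    <= q.+1%:R * (1 + rho) ^+ q.+1 + 2^-1 * (1 + rho) ^+ q.+1.
  rewrite normrM -[leRHS]mul1r ler_pM// (le_trans (ler_normD _ _))//.
  exact: lerD.
rewrite (le_trans (lerD H1 H4))// -!mulrDl ler_wpM2r ?exprn_ge0 ?addr_ge0//.
by rewrite -(natr1 q.+1) sqrrD mulr1 expr1n -mulr_natl; have := ler0n R q.+1; lra.
Qed.
End PowerInequalities.

(** * The approximate recursion between moments of exponents q + 1 and q + 3 *)

Section MomentStep.
Variables (R : realFieldType) (W : finType) (n : nat).
Variables (rho : W -> R) (r t : 'I_n -> W -> R).
Hypothesis walk : unimodular_walk rho r t.

(** Expand [rho ^+ Q] around [r j] to second order. Against functions of [r j], [t j] has mean zero
    and [t j ^+ 2] has the mean of [r j ^+ 2 / 2], so multiplication by [t j] contributes [Q / 2]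
    times the moment. What is left is of one order lower. *)
Lemma cross_moment_step j q :
  `|avg (fun w => (1 + t j w) * rho w ^+ q.+1)
      - (1 + q.+1%:R / 2) * avg (fun w => rho w ^+ q.+1)|
  <= 2 * q.+1%:R ^+ 2 * avg (fun w => (1 + rho w) ^+ q).
Proof.
set Q : R := q.+1%:R.
(* This is [Q / 2] times the power Q - 2, written as a quotient to include Q = 1. Since division by
   zero gives zero, [rg] holds at 0 as well. *)
pose g (x : R) := Q / 2 * x ^+ q.+1 / x ^+ 2.
have rg x : x ^+ 2 * g x = Q / 2 * x ^+ q.+1.
  rewrite /g; have [->|x0] := eqVneq x 0; last by field.
  by rewrite !expr0n /= !mul0r mulr0.
rewrite -[X in `|_ - X|]avgZ -avgB.
have -> : avg (fun w => (1 + t j w) * rho w ^+ q.+1 - (1 + Q / 2) * rho w ^+ q.+1) =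
  avg (fun w => t j w * (rho w ^+ q.+1 - r j w ^+ q.+1 - (2 * t j w + 1) * g (r j w))
     + Q / 2 * (r j w ^+ q.+1 - rho w ^+ q.+1)).
  (* The two added terms have mean zero by [uw_t0] and [uw_tt]. *)
  transitivity (avg (fun w =>
     t j w * (rho w ^+ q.+1 - r j w ^+ q.+1 - (2 * t j w + 1) * g (r j w))
     + Q / 2 * (r j w ^+ q.+1 - rho w ^+ q.+1)
     + t j w * (r j w ^+ q.+1 + g (r j w))
     + (2 * t j w ^+ 2 - r j w ^+ 2) * g (r j w))).
    apply: eq_avg => w; rewrite mulrBl rg; ring.
  rewrite [LHS]avgD (uw_tt walk) addr0 avgD.
  by rewrite (uw_t0 walk j (fun x => x ^+ q.+1 + g x)) addr0.
apply: le_trans (ler_norm_avg _) _; rewrite -avgZ; apply: avg_le => w.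
have [[rho0 r0] t_le] := (uw_rho walk w, uw_r walk j w, uw_t walk j w).
have d1 := uw_dist walk j w.
have P0 : 0 <= (1 + rho w) ^+ q by rewrite exprn_ge0// addr_ge0.
have Q1 : 1 <= Q by rewrite ler1n.
apply: le_trans (ler_normD _ _) _.
have H2 : `|Q / 2 * (r j w ^+ q.+1 - rho w ^+ q.+1)| <= Q ^+ 2 * (1 + rho w) ^+ q.
  rewrite normrM distrC ger0_norm ?divr_ge0//.
  have := distrX_le q rho0 r0 d1; rewrite -/Q => H.
  apply: le_trans (ler_wpM2l _ H) _. lra.
  rewrite mulrA expr2 ler_wpM2r// ler_wpM2r; lra.
suff H1 : `|t j w * (rho w ^+ q.+1 - r j w ^+ q.+1 - (2 * t j w + 1) * g (r j w))|
    <= Q ^+ 2 * (1 + rho w) ^+ q by lra.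
(* If [r j w] vanishes, so does [t j w]. Otherwise the factor [t j w] is at most the factor [r j w]
   built into [second_order_le]. *)
have [rj0|rj0] := eqVneq (r j w) 0.
  move: t_le; rewrite rj0 normr_le0 => /eqP ->; rewrite mul0r normr0.
  by rewrite mulr_ge0// sqr_ge0.
apply: le_trans (second_order_le q r0 rho0 d1).
rewrite (_ : _ - _ - _ * _ * _ = r j w * (rho w ^+ q.+1 - r j w ^+ q.+1
     - (2 * t j w + 1) * g (r j w))); last first.
  rewrite /g (uw_sqr walk j w) !exprS; field => //.
by rewrite 2!normrM ler_wpM2r// (ger0_norm r0).
Qed.

(** Split [rho ^+ q.+3] as [rho ^+ 2 * rho ^+ q.+1] and replace [rho ^+ 2] by the sum of the
    [1 + t j]. *)
Lemma moment_step q :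
  `|avg (fun w => rho w ^+ q.+3)
      - n%:R * ((1 + q.+1%:R / 2) * avg (fun w => rho w ^+ q.+1))|
  <= n%:R * (2 * q.+1%:R ^+ 2 * avg (fun w => (1 + rho w) ^+ q)).
Proof.
have -> : avg (fun w => rho w ^+ q.+3) =
    \sum_j avg (fun w => (1 + t j w) * rho w ^+ q.+1).
  rewrite -avg_sum; apply: eq_avg => w.
  by rewrite -mulr_suml (uw_sum walk w) -exprD.
have sumE (x : R) : n%:R * x = \sum_(j < n) x.
  by rewrite sumr_const card_ord mulr_natl.
rewrite !sumE -sumrB (le_trans (ler_norm_sum _ _ _))//.
by apply: ler_sum => j _; exact: cross_moment_step.
Qed.

Lemma second_moment : avg (fun w => rho w ^+ 2) = n%:R.
Proof.
have -> : avg (fun w => rho w ^+ 2) = \sum_j avg (fun w => 1 + t j w).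
  by rewrite -avg_sum; apply: eq_avg => w; rewrite (uw_sum walk w).
rewrite -[n in RHS]card_ord -sumr_const; apply: eq_bigr => j _.
rewrite avgD (avg_cst _ (uw_card walk)) -[RHS]addr0; congr (_ + _).
by rewrite -(uw_t0 walk j (fun=> 1)); apply: eq_avg => w; rewrite mulr1.
Qed.
End MomentStep.

(** * Uniform moment bounds and reduction to the moments of exponent 0 and 1 *)

Section NormalizedMoments.
Variable R : realType.

(** Here [s] is the square root of [n], and [K] may depend on [q] only. This gives uniformity in the
    order of the roots of unity and in a rotation of the variables. *)
Definition moment_bounded (q : nat) (K : R) : Prop :=
  forall (W : finType) (n : nat) (rho : W -> R) (r t : 'I_n -> W -> R) (s : R),
    unimodular_walk rho r t -> 1 <= s -> s ^+ 2 = n%:R ->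
    avg (fun w => (1 + rho w) ^+ q) <= K * s ^+ q.

Lemma avg_powD1_le (W : finType) (rho : W -> R) q :
  (0 < #|W|)%N -> (forall w, 0 <= rho w) ->
  avg (fun w => (1 + rho w) ^+ q) <= 2 ^+ q * (1 + avg (fun w => rho w ^+ q)).
Proof.
move=> W0 rho0.
have -> : 1 + avg (fun w => rho w ^+ q) = avg (fun w => 1 + rho w ^+ q).
  by rewrite avgD (avg_cst _ W0).
rewrite -avgZ; apply: avg_le => w.
have [rho1|rho1] := leP (rho w) 1.
  apply: (@le_trans _ _ (2 ^+ q)).
    by rewrite lerXn2r// ?nnegrE ?addr_ge0//; lra.
  by rewrite ler_peMr ?exprn_ge0// lerDl exprn_ge0.
apply: (@le_trans _ _ (2 ^+ q * rho w ^+ q)).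
  by rewrite -exprMn lerXn2r// ?nnegrE ?addr_ge0 ?mulr_ge0//; lra.
by rewrite ler_pM2l ?exprn_gt0// lerDr.
Qed.

Lemma moment_bound q : exists2 K : R, 0 <= K & moment_bounded q K.
Proof.
have bound0 : exists2 K : R, 0 <= K & moment_bounded 0 K.
  exists 1 => // W n rho r t s wk _ _; rewrite mulr1.
  by rewrite (@eq_avg _ _ _ (fun=> 1)) ?(avg_cst _ (uw_card wk)).
have bound1 : exists2 K : R, 0 <= K & moment_bounded 1 K.
  exists 2 => // W n rho r t s wk s1 sn; rewrite expr1.
  have s0 : 0 < s by lra.
  have sn0 : s != 0 by rewrite gt_eqF.
  have rhos : avg rho <= s.
    (* The pointwise inequality [2 * s * rho <= s ^+ 2 + rho ^+ 2], averaged with the known second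
       moment. *)
    have -> : s = avg (fun w => 2^-1 * s + (2 * s)^-1 * rho w ^+ 2).
      rewrite avgD (avg_cst _ (uw_card wk)) avgZ (second_moment wk) -sn.
      by field.
    apply: avg_le => w; rewrite -subr_ge0.
    rewrite (_ : _ - _ = (s - rho w) ^+ 2 / (2 * s)); last by field.
    by rewrite divr_ge0 ?sqr_ge0//; lra.
  by rewrite avgD (avg_cst _ (uw_card wk)); lra.
have bound2 : exists2 K : R, 0 <= K & moment_bounded 2 K.
  exists 8 => // W n rho r t s wk s1 sn.
  have := avg_powD1_le 2 (uw_card wk) (uw_rho wk).
  rewrite (second_moment wk) -sn.
  have : 1 <= s ^+ 2 by rewrite expr2; nra.
  lra.
(* Three consecutive exponents are carried, because exponent q + 3 uses exponent q + 1 in the main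
   term and exponent q in the error. *)
suff: (exists2 K : R, 0 <= K & moment_bounded q K) /\
   (exists2 K : R, 0 <= K & moment_bounded q.+1 K) /\
   (exists2 K : R, 0 <= K & moment_bounded q.+2 K) by case.
elim: q => [//|q [[K K0 HK] [[K1 K10 HK1] bq2]]]; split; first by exists K1.
split=> //.
exists (2 ^+ q.+3 * (1 + ((1 + q.+1%:R / 2) * K1 + 2 * q.+1%:R ^+ 2 * K))).
  by rewrite !(exprn_ge0, mulr_ge0, addr_ge0, invr_ge0, ler0n).
move=> W n rho r t s wk s1 sn.
apply: le_trans (avg_powD1_le q.+3 (uw_card wk) (uw_rho wk)) _.
rewrite -[leRHS]mulrA ler_pM2l ?exprn_gt0// mulrDl mul1r lerD ?exprn_ege1//.
have s0 : 0 < s by lra.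
have E1 : avg (fun w => rho w ^+ q.+1) <= K1 * s ^+ q.+1.
  apply: le_trans (HK1 _ _ _ _ _ _ wk s1 sn); apply: avg_le => w.
  by rewrite lerXn2r// ?nnegrE ?addr_ge0 ?(uw_rho wk)// lerDr.
have E0 : avg (fun w => (1 + rho w) ^+ q) <= K * s ^+ q.+1.
  apply: le_trans (HK _ _ _ _ _ _ wk s1 sn) _.
  by rewrite ler_wpM2l// exprS ler_peMl ?exprn_ge0//; lra.
have := moment_step wk q; rewrite ler_distl => /andP[_ /le_trans]; apply.
rewrite -mulrDr -sn -[q.+3]/(2 + q.+1)%N exprD [leRHS]mulrCA ler_pM2l ?exprn_gt0//.
rewrite [leRHS]mulrDl lerD// -[leRHS]mulrA ler_wpM2l// ?(addr_ge0, mulr_ge0, exprn_ge0)//.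
Qed.

(** For even q this is the factorial of q/2, for odd q it is Gamma(1 + q/2) / Gamma(3/2). *)
Fixpoint moment_factor (q : nat) : R :=
  if q is q'.+2 then (1 + q'%:R / 2) * moment_factor q' else 1.

Lemma moment_factor_gt0 q : 0 < moment_factor q.
Proof.
suff: 0 < moment_factor q /\ 0 < moment_factor q.+1 by case.
elim: q => [|q [IH1 IH2]]; first by rewrite /= ltr01.
by split=> //=; rewrite mulr_gt0// ltr_wpDr.
Qed.

Lemma moment_factorE (G : nat -> R) q :
  (forall k, G k.+2 = (1 + k%:R / 2) * G k) ->
  G q = moment_factor q * G (odd q).
Proof.
move=> HG; suff: G q = moment_factor q * G (odd q) /\
  G q.+1 = moment_factor q.+1 * G (odd q.+1) by case.
elim: q => [|q [IH1 IH2]]; first by rewrite !mul1r.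
by split=> //=; rewrite HG IH1 negbK mulrA.
Qed.

(** For [q = 0] the relation is exact, the second moment being [n]. Otherwise divide [moment_step]
    by [s ^+ q.+2]; its error is of order [s ^+ q.+1]. *)
Lemma normalized_moment_step q : exists2 C : R, 0 <= C &
  forall (W : finType) (n : nat) (rho : W -> R) (r t : 'I_n -> W -> R) (s : R),
    unimodular_walk rho r t -> 1 <= s -> s ^+ 2 = n%:R ->
  `|avg (fun w => (rho w / s) ^+ q.+2)
     - (1 + q%:R / 2) * avg (fun w => (rho w / s) ^+ q)| <= C / s.
Proof.
have avgE (W : finType) (rho : W -> R) (s : R) k :
    avg (fun w => (rho w / s) ^+ k) = (s ^+ k)^-1 * avg (fun w => rho w ^+ k).
  by rewrite -avgZ; apply: eq_avg => w; rewrite exprMn exprVn mulrC.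
case: q => [|q].
  exists 0 => // W n rho r t s wk s1 sn.
  have s0 : s != 0 by rewrite gt_eqF//; lra.
  rewrite !avgE (second_moment wk) -sn mulVf ?expf_neq0//.
  rewrite (@eq_avg _ _ (fun w => rho w ^+ 0) (fun=> 1)) ?(avg_cst _ (uw_card wk))//.
  by rewrite !mul0r expr0 invr1 !mulr1 addr0 subrr normr0.
have [K K0 HK] := moment_bound q.
exists (2 * q.+1%:R ^+ 2 * K); first by rewrite !mulr_ge0 ?exprn_ge0.
move=> W n rho r t s wk s1 sn.
have s0 : 0 < s by lra.
have sn0 : s != 0 by rewrite gt_eqF.
rewrite !avgE.
rewrite (_ : _ - _ = (s ^+ q.+3)^-1 * (avg (fun w => rho w ^+ q.+3)
  - n%:R * ((1 + q.+1%:R / 2) * avg (fun w => rho w ^+ q.+1)))); last first.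
  by rewrite -sn !exprS; field; rewrite sn0 expf_neq0.
rewrite normrM ger0_norm ?invr_ge0 ?exprn_ge0 ?(ltW s0)//.
rewrite ler_pdivrMl ?exprn_gt0//.
apply: le_trans (moment_step wk q) _.
rewrite (_ : _ * (_ / s) = n%:R * (2 * q.+1%:R ^+ 2 * (K * s ^+ q))); last first.
  by rewrite -sn !exprS; field.
rewrite ler_wpM2l// ler_wpM2l ?mulr_ge0 ?exprn_ge0//.
exact: HK wk s1 sn.
Qed.

(** Iterating the recursion by steps of two ends at exponent 0 or 1, so that the first moment is the
    only unknown left. *)
Lemma normalized_moment_odd q : exists2 C : R, 0 <= C &
  forall (W : finType) (n : nat) (rho : W -> R) (r t : 'I_n -> W -> R) (s : R),
    unimodular_walk rho r t -> 1 <= s -> s ^+ 2 = n%:R ->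
  `|avg (fun w => (rho w / s) ^+ q)
     - moment_factor q * avg (fun w => (rho w / s) ^+ odd q)| <= C / s.
Proof.
pose P q := exists2 C : R, 0 <= C &
  forall (W : finType) (n : nat) (rho : W -> R) (r t : 'I_n -> W -> R) (s : R),
    unimodular_walk rho r t -> 1 <= s -> s ^+ 2 = n%:R ->
  `|avg (fun w => (rho w / s) ^+ q)
     - moment_factor q * avg (fun w => (rho w / s) ^+ odd q)| <= C / s.
suff: P q /\ P q.+1 by case.
elim: q => [|q [[C C0 HC] IH2]].
  by split; exists 0 => // *; rewrite !mul0r mul1r subrr normr0.
split=> //; have [D D0 HD] := normalized_moment_step q.
exists (D + (1 + q%:R / 2) * C).
  by rewrite !(mulr_ge0, addr_ge0, invr_ge0).
move=> W n rho r t s wk s1 sn.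
have := HC _ _ _ _ _ _ wk s1 sn; have := HD _ _ _ _ _ _ wk s1 sn.
set a := avg _; set b := avg _; set c := avg _ => H1 H2.
rewrite [odd _]/= negbK -/c [moment_factor _]/=.
rewrite (_ : _ - _ = (a - (1 + q%:R / 2) * b)
  + (1 + q%:R / 2) * (b - moment_factor q * c)); last by ring.
rewrite (le_trans (ler_normD _ _))// [leRHS]mulrDl lerD// normrM -[leRHS]mulrA.
by rewrite ger0_norm ?ler_wpM2l// ?addr_ge0 ?divr_ge0.
Qed.
End NormalizedMoments.

(** * The limit of the moments by a Bohr-Mollerup argument *)

Section MomentLimit.
Variable R : realType.
Local Notation gam := (@moment_factor R).

Lemma moment_factor_even m : gam m.*2.+2 = (m%:R + 1) * gam m.*2.
Proof. by rewrite /= -mul2n natrM; field. Qed.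

Lemma moment_factor_odd m : gam m.*2.+3 = (m%:R + 3 / 2) * gam m.*2.+1.
Proof. by rewrite /= -natr1 -mul2n natrM; field. Qed.

(** Induction on [m]: the left side gains the factor (m + 1)(m + 2) and the right side (m + 3/2)^2,
    which is larger. *)
Lemma moment_factor_ratio_le m :
  gam m.*2 * gam m.*2.+2 <= gam m.*2.+1 ^+ 2.
Proof.
elim: m => [|m IH]; first by rewrite /= mul0r addr0 mul1r expr1n.
rewrite (moment_factor_even m.+1) doubleS (moment_factor_even m) moment_factor_odd -natr1.
have g0 := moment_factor_gt0 R m.*2; have g1 := moment_factor_gt0 R m.*2.+1.
move: IH; rewrite moment_factor_even.
move: (gam m.*2) (gam m.*2.+1) g0 g1 => a b a0 b0 IH.
have x0 := ler0n R m; set x : R := m%:R in x0 IH *.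
apply: (@le_trans _ _ ((x + 1) * (x + 2) * b ^+ 2)).
  rewrite [leLHS](_ : _ = (x + 1) * (x + 2) * (a * ((x + 1) * a))); last by ring.
  by apply: ler_wpM2l IH; apply: mulr_ge0; lra.
by rewrite exprMn; apply: ler_wpM2r; [exact: sqr_ge0 | nra].
Qed.

(* With a, c the even factors and b, e the odd ones this is Bohr-Mollerup:
   log-convexity at 2m+1 and at 2m+2 squeezes the square of the first moment
   between c^2/(b e) and a c / b^2, up to an error of order delta. *)
Lemma log_convex_squeeze (a b c e u v x y z w delta : R) :
  0 < a -> 0 < b -> 0 < c -> 0 < e -> 0 <= delta <= 1 -> 0 <= u <= 1 ->
  0 <= x -> 0 <= y -> 0 <= z -> 0 <= w ->
  `|x - a| <= delta -> `|y - b * u| <= delta ->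
  `|z - c| <= delta -> `|w - e * u| <= delta ->
  y ^+ 2 <= x * z -> z ^+ 2 <= y * w ->
  (b * v) ^+ 2 <= a * c -> c ^+ 2 <= b * v * (e * v) ->
  `|u ^+ 2 - v ^+ 2| <= a * c / b ^+ 2 - c ^+ 2 / (b * e)
     + delta * ((a + c + 2 * b + 4) / b ^+ 2 + (b + e + 2 * c + 4) / (b * e)).
Proof.
move=> a0 b0 c0 e0 /andP[d0 d1] /andP[u0 u1] x0 y0 z0 w0.
move=> /ler_normlP[xa1 xa2] /ler_normlP[yb1 yb2] /ler_normlP[zc1 zc2].
move=> /ler_normlP[we1 we2] yy zz bv cv.
have bu0 : 0 <= b * u by rewrite mulr_ge0// ltW.
have eu0 : 0 <= e * u by rewrite mulr_ge0// ltW.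
have bu1 : b * u <= b by rewrite ler_piMr// ltW.
have eu1 : e * u <= e by rewrite ler_piMr// ltW.
have dd : delta * delta <= delta by rewrite ler_piMr.
have up : (b * u) ^+ 2 <= a * c + delta * (a + c + 2 * b + 4).
  have h1 : (b * u) ^+ 2 <= (y + delta) ^+ 2.
    by rewrite lerXn2r// ?nnegrE; lra.
  have h2 : x * z <= (a + delta) * (c + delta) by apply: ler_pM; lra.
  have h3 : y * delta <= (b + delta) * delta by apply: ler_wpM2r; lra.
  rewrite sqrrD in h1; lra.
have lo : c ^+ 2 <= b * e * u ^+ 2 + delta * (b + e + 2 * c + 4).
  have h1 : c ^+ 2 <= (z + delta) ^+ 2.
    by rewrite lerXn2r// ?nnegrE; lra.
  have h2 : y * w <= (b * u + delta) * (e * u + delta) by apply: ler_pM; lra.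
  have h3 : z * delta <= (c + delta) * delta by apply: ler_wpM2r; lra.
  have h4 : b * u * delta <= b * delta by apply: ler_wpM2r; lra.
  have h5 : e * u * delta <= e * delta by apply: ler_wpM2r; lra.
  rewrite sqrrD in h1; lra.
set L1 := a + c + 2 * b + 4 in up *; set L2 := b + e + 2 * c + 4 in lo *.
have bb : 0 < b ^+ 2 by rewrite exprn_gt0.
have be : 0 < b * e by rewrite mulr_gt0.
have hu1 : u ^+ 2 <= a * c / b ^+ 2 + delta * (L1 / b ^+ 2).
  by rewrite mulrA -mulrDl ler_pdivlMr// mulrC -exprMn.
have hv1 : v ^+ 2 <= a * c / b ^+ 2.
  by rewrite ler_pdivlMr// mulrC -exprMn.
have hu2 : c ^+ 2 / (b * e) <= u ^+ 2 + delta * (L2 / (b * e)).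
  by rewrite ler_pdivrMr// mulrDl mulrA divfK ?gt_eqF// [u ^+ 2 * _]mulrC.
have hv2 : c ^+ 2 / (b * e) <= v ^+ 2.
  by rewrite ler_pdivrMr//; apply: le_trans cv _; lra.
have k1 : 0 <= delta * (L1 / b ^+ 2).
  by rewrite mulr_ge0// divr_ge0// ?(ltW bb)// /L1; lra.
have k2 : 0 <= delta * (L2 / (b * e)).
  by rewrite mulr_ge0// divr_ge0// ?(ltW be)// /L2; lra.
by rewrite ler_norml; apply/andP; split; lra.
Qed.

Variable G : nat -> R.
Hypotheses (G0 : G 0%N = 1) (G1 : 0 < G 1%N).
Hypothesis Grec : forall k, G k.+2 = (1 + k%:R / 2) * G k.
Hypothesis Gconvex : forall k, G k.+1 ^+ 2 <= G k * G k.+2.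

Definition moment_tends (q : nat) : Prop := forall eps : R, 0 < eps ->
  exists2 s0 : R, 1 <= s0 &
  forall (W : finType) (n : nat) (rho : W -> R) (r t : 'I_n -> W -> R) (s : R),
    unimodular_walk rho r t -> s0 <= s -> s ^+ 2 = n%:R ->
  `|avg (fun w => (rho w / s) ^+ q) - G q| <= eps.

(** Cauchy-Schwarz for the powers k/2 and k/2 + 1 of [f]. *)
Lemma avg_log_convex (W : finType) (f : W -> R) k : (forall w, 0 <= f w) ->
  avg (fun w => f w ^+ k.+1) ^+ 2 <=
  avg (fun w => f w ^+ k) * avg (fun w => f w ^+ k.+2).
Proof.
move=> f0.
have := avg_cauchy_schwarz (fun w => Num.sqrt (f w) ^+ k)
  (fun w => Num.sqrt (f w) ^+ k.+2).
rewrite (@eq_avg _ _ (fun w => _ * _) (fun w => f w ^+ k.+1)); last first.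
  move=> w; rewrite -exprD (_ : (k + k.+2 = 2 * k.+1)%N); last by lia.
  by rewrite exprM sqr_sqrtr.
have sqrE l w : (Num.sqrt (f w) ^+ l) ^+ 2 = f w ^+ l.
  by rewrite exprAC sqr_sqrtr.
by rewrite (eq_avg (sqrE k)) (eq_avg (sqrE k.+2)).
Qed.

(** The first moment and [G 1] satisfy the same log-convexity inequalities, the former up to
    [C / s]. These confine both squares to an interval whose width tends to 0 with [m]. First [m] is
    fixed, then [s] is taken large. *)
Lemma first_moment_tends : moment_tends 1.
Proof.
move=> eps eps0.
have v0 := G1; set v := G 1%N in v0 *.
have ve0 : 0 < v * eps / 2 by rewrite divr_gt0// mulr_gt0.
(* The width of the squeeze is at most 1 / (2m + 3), which this [m] brings below [v * eps / 2]. *)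
pose m := Num.truncn (v * eps / 2)^-1.
set a := gam m.*2; set b := gam m.*2.+1; set c := gam m.*2.+2.
set e := gam m.*2.+3.
have a0 : 0 < a := moment_factor_gt0 _ _.
have b0 : 0 < b := moment_factor_gt0 _ _.
have c0 : 0 < c := moment_factor_gt0 _ _.
have e0 : 0 < e := moment_factor_gt0 _ _.
have cE : c = (m%:R + 1) * a := moment_factor_even _.
have eE : e = (m%:R + 3 / 2) * b := moment_factor_odd _.
have gap : a * c / b ^+ 2 - c ^+ 2 / (b * e) <= v * eps / 2.
  have m0 : 0 <= m%:R :> R := ler0n _ _.
  rewrite (_ : _ - _ = (a * c / b ^+ 2) * (2 * m%:R + 3)^-1); last first.
    rewrite cE eE; field; rewrite (gt_eqF b0) andbT gt_eqF//; lra.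
  apply: (@le_trans _ _ (2 * m%:R + 3)^-1).
    rewrite ler_piMl ?invr_ge0//.
    by rewrite ler_pdivrMr ?exprn_gt0// mul1r; exact: moment_factor_ratio_le.
  rewrite -[leRHS]invrK lef_pV2 ?posrE ?invr_gt0//.
  have := truncnS_gt (v * eps / 2)^-1; rewrite -/m -natr1; lra.
have Godd k : odd k -> G k = gam k * v.
  by move=> ok; rewrite (moment_factorE k Grec) ok.
have Geven k : ~~ odd k -> G k = gam k.
  by move=> ok; rewrite (moment_factorE k Grec) (negPf ok) G0 mulr1.
have Ga : G m.*2 = a by rewrite Geven// odd_double.
have Gb : G m.*2.+1 = b * v by rewrite Godd//= odd_double.
have Gc : G m.*2.+2 = c by rewrite Geven//= negbK odd_double.
have Ge : G m.*2.+3 = e * v by rewrite Godd//= negbK odd_double.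
have [Ca Ca0 HCa] := normalized_moment_odd R m.*2.
have [Cb Cb0 HCb] := normalized_moment_odd R m.*2.+1.
have [Cc Cc0 HCc] := normalized_moment_odd R m.*2.+2.
have [Ce Ce0 HCe] := normalized_moment_odd R m.*2.+3.
pose C := Ca + Cb + Cc + Ce.
pose L := (a + c + 2 * b + 4) / b ^+ 2 + (b + e + 2 * c + 4) / (b * e).
have L0 : 0 <= L.
  apply: addr_ge0; apply: divr_ge0; first lra.
  - exact: sqr_ge0.
  - lra.
  - by rewrite mulr_ge0// ltW.
have C0 : 0 <= C by rewrite /C; lra.
have CL : 0 <= C * L / (v * eps / 2) by rewrite divr_ge0 ?mulr_ge0// ltW.
(* The summand [C] ensures [C / s <= 1], the last one [C / s * L <= v * eps / 2]. *)
exists (1 + C + C * L / (v * eps / 2)); first by lra.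
move=> W n rho r t s wk s0s sn.
have s1 : 1 <= s by lra.
have sgt0 : 0 < s by lra.
have f0 w : 0 <= rho w / s by rewrite divr_ge0 ?(uw_rho wk)// ltW.
pose M k := avg (fun w => (rho w / s) ^+ k).
have M_ge0 k : 0 <= M k by apply: avg_ge0 => w; rewrite exprn_ge0.
have M0 : M 0%N = 1.
  by rewrite /M (@eq_avg _ _ _ (fun=> 1)) ?(avg_cst _ (uw_card wk)).
have M2 : M 2%N = 1.
  have := normalized_moment_step R 0.
  rewrite /M (@eq_avg _ _ _ (fun w => (s ^+ 2)^-1 * rho w ^+ 2)).
    by rewrite avgZ (second_moment wk) sn mulVf// -sn expf_neq0 ?gt_eqF.
  by move=> w; rewrite exprMn exprVn mulrC.
have Mconv k : M k.+1 ^+ 2 <= M k * M k.+2 by exact: avg_log_convex.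
have u1 : M 1%N <= 1.
  have := Mconv 0%N; rewrite M0 M2 mul1r expr_le1//.
have Hd D : 0 <= D -> D <= C -> D / s <= C / s.
  by move=> D0 DC; rewrite ler_wpM2r// invr_ge0 ltW.
have dC : 0 <= C / s <= 1.
  by rewrite divr_ge0 ?ler_pdivrMr ?mul1r//=; lra.
have := @log_convex_squeeze a b c e (M 1%N) v (M m.*2) (M m.*2.+1) (M m.*2.+2)
  (M m.*2.+3) (C / s) a0 b0 c0 e0 dC.
rewrite M_ge0 u1 => /(_ isT (M_ge0 _) (M_ge0 _) (M_ge0 _) (M_ge0 _)).
have odd1 k : odd k -> avg (fun w => (rho w / s) ^+ odd k) = M 1%N by move=> ->.
have even1 k : ~~ odd k -> avg (fun w => (rho w / s) ^+ odd k) = 1.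
  by move=> /negPf ->; exact: M0.
have Ob : odd m.*2.+1 by rewrite /= odd_double.
have Ec : ~~ odd m.*2.+2 by rewrite /= negbK odd_double.
have Oe : odd m.*2.+3 by rewrite /= negbK odd_double.
have ha : `|M m.*2 - a| <= C / s.
  have := HCa _ _ _ _ _ _ wk s1 sn; rewrite even1 ?odd_double// mulr1 => /le_trans.
  by apply; apply: Hd => //; rewrite /C; lra.
have hb : `|M m.*2.+1 - b * M 1%N| <= C / s.
  have := HCb _ _ _ _ _ _ wk s1 sn; rewrite (odd1 _ Ob) => /le_trans.
  by apply; apply: Hd => //; rewrite /C; lra.
have hc : `|M m.*2.+2 - c| <= C / s.
  have := HCc _ _ _ _ _ _ wk s1 sn; rewrite (even1 _ Ec) mulr1 => /le_trans.
  by apply; apply: Hd => //; rewrite /C; lra.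
have he : `|M m.*2.+3 - e * M 1%N| <= C / s.
  have := HCe _ _ _ _ _ _ wk s1 sn; rewrite (odd1 _ Oe) => /le_trans.
  by apply; apply: Hd => //; rewrite /C; lra.
move=> /(_ ha hb hc he (Mconv _) (Mconv _)).
have := Gconvex m.*2; have := Gconvex m.*2.+1; rewrite Ga Gb Gc Ge => q1 q2.
move=> /(_ q2 q1); rewrite -/L => H.
have CsL : C / s * L <= v * eps / 2.
  rewrite mulrAC ler_pdivrMr// [leRHS]mulrC -ler_pdivrMr//; lra.
have {}H : `|M 1%N ^+ 2 - v ^+ 2| <= v * eps by lra.
(* Pass from squares to first powers: the sum [M 1 + v] is at least [v]. *)
rewrite -/(M 1%N) -(ler_pM2l v0); apply: le_trans H.
rewrite subr_sqr normrM mulrC ler_wpM2l// ger0_norm; last first.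
  by rewrite addr_ge0// ltW.
by rewrite lerDr.
Qed.

Lemma all_moments_tend q : moment_tends q.
Proof.
move=> eps eps0.
have [C C0 HC] := normalized_moment_odd R q.
have g0 := moment_factor_gt0 R q.
have odd_tends : moment_tends (odd q).
  case: (odd q); first exact: first_moment_tends.
  move=> eps' eps'0; exists 1 => // W n rho r t s wk _ _.
  rewrite (@eq_avg _ _ _ (fun=> 1)) ?(avg_cst _ (uw_card wk))//.
  by rewrite G0 subrr normr0 ltW.
have [|s0 s01 Hs0] := odd_tends (eps / 2 / gam q); first by rewrite !divr_gt0.
exists (s0 + C / (eps / 2)).
  by rewrite ler_wpDr// divr_ge0// divr_ge0// ltW.
move=> W n rho r t s wk s0s sn.
have Ce : 0 <= C / (eps / 2) by rewrite divr_ge0// divr_ge0// ltW.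
have s1 : 1 <= s by lra.
have sgt0 : 0 < s by lra.
have s0s' : s0 <= s by lra.
have h1 := HC _ _ _ _ _ _ wk s1 sn.
have h2 := Hs0 _ _ _ _ _ _ wk s0s' sn.
rewrite (moment_factorE q Grec).
set x := avg _ in h1 *; set y := avg _ in h1 h2.
rewrite (_ : _ - _ = (x - gam q * y) + gam q * (y - G (odd q))); last by ring.
apply: le_trans (ler_normD _ _) _; rewrite normrM (gtr0_norm g0).
have h3 : C / s <= eps / 2.
  rewrite ler_pdivrMr// mulrC -ler_pdivrMr ?divr_gt0//; lra.
have h4 : gam q * `|y - G (odd q)| <= eps / 2.
  by rewrite mulrC -ler_pdivlMr.
lra.
Qed.
End MomentLimit.

(** * Half-integer values of the Gamma function *)

Section EulerIntegral.
Variable R : realType.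
Notation mu := (@lebesgue_measure R).
Implicit Types a t : R.

Let euler a t : R := t `^ a * expR (- t).
Let euler_integral a : R := \int[mu]_(t in `]0, +oo[) euler a t.

Lemma powR_le_expR a : 0 <= a ->
  exists2 K : R, 0 <= K & forall t, 0 <= t -> t `^ a <= K * expR (t / 2).
Proof.
move=> a0; pose N := Num.truncn a.
have aN : a <= N.+1%:R by rewrite ltW// truncnS_gt.
exists (2 ^+ N.+1 * N.+1`!%:R); first by rewrite mulr_ge0 ?exprn_ge0.
move=> t t0.
have h : t `^ a <= 1 + t ^+ N.+1.
  have [t1|t1] := leP t 1.
    rewrite ler_wpDr ?exprn_ge0//.
    by apply: le_trans (ge0_ler_powR a0 _ _ t1) _; rewrite ?nnegrE// powR1.
  rewrite ler_wpDl// -powR_mulrn// ler_powR// ltW//.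
apply: le_trans h _.
have := expR_ge1Dxn N (_ : 0 <= t / 2); rewrite divr_ge0// => /(_ isT) h.
have P0 : 0 < (2 ^+ N.+1 * N.+1`!%:R : R).
  by rewrite mulr_gt0 ?exprn_gt0// ltr0n fact_gt0.
apply: le_trans (ler_wpM2l (ltW P0) h).
rewrite mulrDr lerD//.
  rewrite mulr1 mulr_ege1// ?exprn_ege1//; first by lra.
  by rewrite ler1n fact_gt0.
rewrite expr_div_n (_ : _ * (_ / _) = t ^+ N.+1)//; field.
by rewrite expf_neq0//= pnatr_eq0 -lt0n fact_gt0.
Qed.

Lemma measurable_euler a : measurable_fun setT (euler a).
Proof.
apply: measurable_funM; first exact: measurable_powR.
by apply: measurableT_comp => //; exact: measurable_funN.
Qed.

Lemma expRN_cvgy (c : R) : 0 < c -> expR (- (c * t)) @[t --> +oo] --> 0.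
Proof.
move=> c0.
apply: (@cvg_comp _ _ _ _ (fun x => expR (- x)) _ (pinfty_nbhs R)); last exact: cvgr_expR.
by apply: gt0_cvgMry => //; exact: cvg_id.
Qed.

Lemma expR_FTC (c : R) : 0 < c ->
  (\int[mu]_(t in `[0%R, +oo[) (expR (- (c * t)))%:E = (c^-1)%:E)%E.
Proof.
move=> c0.
have der (t : R) : is_derive t 1 (fun t => - c^-1 * expR (- (c * t))) (expR (- (c * t))).
  apply: is_derive_eq.
  by rewrite /GRing.scale/=; field; rewrite gt_eqF.
have cont : continuous (fun t => expR (- (c * t)) : R).
  by move=> t; apply: (differentiable_continuous (f := fun t => expR (- (c * t)) : R));
    apply/derivable1_diffP; apply: ex_derive.
rewrite (@ge0_continuous_FTC2y _ _ (fun t => - c^-1 * expR (- (c * t))) 0 0).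
- by rewrite mulr0 oppr0 expR0 mulr1 EFinN sub0e oppeK.
- by move=> x _; exact: expR_ge0.
- exact: continuous_subspaceT.
- rewrite -(mulr0 (- c^-1)); apply: cvgM; first exact: cvg_cst.
  by apply: expRN_cvgy; rewrite ?invr_gt0.
- by move=> x _; exact: ex_derive.
- by apply: cvgM; [exact: cvg_cst | apply/cvg_at_right_filter; exact: cont].
- by move=> x _; rewrite derive1E; exact: derive_val.
Qed.

Lemma integrable_scale (D : set (measurableTypeR R)) (f : R -> R) c : measurable D ->
  mu.-integrable D (EFin \o f) -> mu.-integrable D (EFin \o (fun t => c * f t)).
Proof.
by move=> mD fi; apply: eq_integrable (integrableZl mD c fi).
Qed.

Lemma integrable_EFinD (D : set (measurableTypeR R)) (f g : R -> R) : measurable D ->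
  mu.-integrable D (EFin \o f) -> mu.-integrable D (EFin \o g) ->
  mu.-integrable D (EFin \o (fun t => f t + g t)).
Proof. by move=> mD fi gi; apply: eq_integrable (integrableD mD fi gi). Qed.

Lemma integrable_EFinB (D : set (measurableTypeR R)) (f g : R -> R) : measurable D ->
  mu.-integrable D (EFin \o f) -> mu.-integrable D (EFin \o g) ->
  mu.-integrable D (EFin \o (fun t => f t - g t)).
Proof. by move=> mD fi gi; apply: eq_integrable (integrableB mD fi gi). Qed.

Lemma measurable_expRN (c : R) : measurable_fun setT (fun t => expR (- (c * t))).
Proof.
apply: measurableT_comp => //; apply: measurable_funN.
exact: measurable_funM.
Qed.

Lemma integrable_expRN (c : R) : 0 < c ->
  mu.-integrable `[0, +oo[ (EFin \o (fun t => expR (- (c * t)))).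
Proof.
move=> c0; apply/integrableP; split.
  by apply/measurable_EFinP; apply: measurable_funTS; exact: measurable_expRN.
under eq_integral do rewrite /= ger0_norm ?expR_ge0//.
by rewrite expR_FTC// ltry.
Qed.

Lemma euler_le a : 0 <= a ->
  exists2 K : R, 0 <= K & forall t, 0 <= t -> euler a t <= K * expR (- (2^-1 * t)).
Proof.
move=> /powR_le_expR[K K0 HK]; exists K => // t t0.
have -> : - (2^-1 * t) = t / 2 + - t by field.
by rewrite expRD mulrA ler_wpM2r ?expR_ge0// HK.
Qed.

Lemma euler_ge0 a t : 0 <= euler a t.
Proof. by rewrite mulr_ge0 ?powR_ge0 ?expR_ge0. Qed.

Lemma integrable_euler_closed a : 0 <= a ->
  mu.-integrable `[0, +oo[ (EFin \o euler a).
Proof.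
move=> /euler_le[K K0 HK].
have iK : mu.-integrable `[0, +oo[ (EFin \o (fun t => K * expR (- (2^-1 * t)))).
  by apply: integrable_scale => //; apply: integrable_expRN; rewrite invr_gt0.
apply: le_integrable iK => //.
- by apply/measurable_EFinP; apply: measurable_funTS; exact: measurable_euler.
- move=> t; rewrite /= in_itv/= andbT => t0; rewrite lee_fin.
  by rewrite !ger0_norm ?euler_ge0 ?mulr_ge0 ?expR_ge0// HK.
Qed.

Lemma integrable_euler a : 0 <= a -> mu.-integrable `]0, +oo[ (EFin \o euler a).
Proof.
move=> a0; apply: (integrableS _ _ _ (integrable_euler_closed a0)) => //.
by move=> t; rewrite /= !in_itv/= !andbT; exact: ltW.
Qed.

Lemma euler_integral_closed a : 0 <= a ->
  euler_integral a = \int[mu]_(t in `[0, +oo[) euler a t.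
Proof.
move=> a0; rewrite /euler_integral Rintegral_itv_obnd_cbnd//.
exact: integrable_euler.
Qed.

Lemma euler_integral0 : euler_integral 0 = 1.
Proof.
rewrite euler_integral_closed// /Rintegral.
under eq_integral do rewrite /euler powRr0 mul1r -[X in - X]mul1r.
by rewrite expR_FTC// invr1.
Qed.

Lemma euler_integral_ge0 a : 0 <= euler_integral a.
Proof. by apply: Rintegral_ge0 => t _; exact: euler_ge0. Qed.

Lemma euler_at_right0 a : 0 <= a -> euler a t @[t --> 0^'+] --> euler a 0.
Proof.
move=> a0; apply: cvgM.
  have [->|an0] := eqVneq a 0.
    by under eq_fun do rewrite powRr0; rewrite powRr0; exact: cvg_cst.
  by rewrite powR0//; apply: powR_cvg0; rewrite lt_neqAle eq_sym an0.
apply: cvg_at_right_filter; apply: (@continuous_comp _ _ _ -%R expR).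
  exact: opp_continuous.
exact: continuous_expR.
Qed.

Lemma euler_continuous a t : 0 < t -> {for t, continuous (euler a)}.
Proof.
move=> t0; have h := is_derive1_powR a t0.
by apply: differentiable_continuous; apply/derivable1_diffP; apply: ex_derive.
Qed.

Lemma euler_derive a t : 0 < t ->
  is_derive t 1 (euler (a + 1)) ((a + 1) * euler a t - euler (a + 1) t).
Proof.
move=> t0; have h := is_derive1_powR (a + 1) t0.
apply: is_derive_eq; rewrite /euler /GRing.scale/= addrK; ring.
Qed.

Lemma euler_cvgy a : 0 <= a -> euler a t @[t --> +oo] --> 0.
Proof.
move=> /euler_le[K K0 HK].
apply: (@squeeze_cvgr _ _ _ _ (cst 0) (fun t => K * expR (- (2^-1 * t)))).
- by near=> t; rewrite euler_ge0/= HK.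
- exact: cvg_cst.
- rewrite -(mulr0 (K)); apply: cvgM; first exact: cvg_cst.
  by apply: expRN_cvgy; rewrite ?invr_gt0.
Unshelve. all: by end_near.
Qed.

(* The library's fundamental theorem on a half-line wants a nonnegative
   integrand; adding the multiple [e] of [exp (- t / 2)] provides it. *)
Lemma euler_integral_rec a : 0 <= a ->
  euler_integral (a + 1) = (a + 1) * euler_integral a.
Proof.
move=> a0; have a1 : 0 <= a + 1 by lra.
have [K K0 HK] := euler_le a0.
(* With this constant [e] dominates [(a + 1) * euler a], whence [g] is nonnegative; [F] is a
   primitive of [g]. *)
pose L := (a + 1) * K.
have L0 : 0 <= L by rewrite mulr_ge0.
pose e t := L * expR (- (2^-1 * t)).
pose g t := euler (a + 1) t - (a + 1) * euler a t + e t.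
pose F t := - euler (a + 1) t - 2 * e t.
have der (t : R) : 0 < t -> is_derive t 1 F (g t).
  move=> t0; have h := euler_derive a t0.
  by rewrite /F/e; apply: is_derive_eq; rewrite /g /e /GRing.scale/=; field.
have ce : continuous e.
  move=> t; apply: (differentiable_continuous (f := e));
    apply/derivable1_diffP; apply: ex_derive.
have ie : mu.-integrable `[0, +oo[ (EFin \o e).
  by apply: integrable_scale => //; apply: integrable_expRN; rewrite invr_gt0.
have ia : mu.-integrable `[0, +oo[ (EFin \o (fun t => (a + 1) * euler a t)).
  by apply: integrable_scale => //; exact: integrable_euler_closed.
have ia1 := integrable_euler_closed a1.
have int_e : \int[mu]_(t in `[0, +oo[) e t = 2 * L.
  rewrite /e RintegralZl//; last exact: integrable_expRN.
  by rewrite /Rintegral expR_FTC//= invrK mulrC.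
have int_g : \int[mu]_(t in `[0, +oo[) g t = 2 * L.
  rewrite (@Rintegral_ge0_continuous_FTC2y _ _ F 0 0).
  - rewrite /F /e /euler mulr0 oppr0 expR0 powR0 ?gt_eqF//; last by lra.
    ring.
  - move=> t t0; rewrite /g /e /L.
    rewrite (_ : _ + _ = euler (a + 1) t
      + (a + 1) * (K * expR (- (2^-1 * t)) - euler a t)); last by ring.
    by rewrite addr_ge0 ?euler_ge0// mulr_ge0// subr_ge0 HK.
  - apply/continuous_within_itvcyP; split.
      move=> t; rewrite in_itv/= andbT => t0.
      apply: cvgD; last exact: ce.
      apply: cvgB; first exact: euler_continuous.
      by apply: cvgM; [exact: cvg_cst | exact: euler_continuous].
    apply: cvgD; last by apply: cvg_at_right_filter; exact: ce.
    apply: cvgB; first exact: euler_at_right0.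
    by apply: cvgM; [exact: cvg_cst | exact: euler_at_right0].
  - rewrite /F (_ : 0 = - 0 - 2 * 0); last by ring.
    apply: cvgB; first by apply: cvgN; exact: euler_cvgy.
    apply: cvgM; first exact: cvg_cst.
    rewrite -(mulr0 L); apply: cvgM; first exact: cvg_cst.
    by apply: expRN_cvgy; rewrite invr_gt0.
  - by move=> t t0; case: (der t t0).
  - apply: cvgB; first by apply: cvgN; exact: euler_at_right0.
    by apply: cvgM; [exact: cvg_cst | apply: cvg_at_right_filter; exact: ce].
  - move=> t; rewrite in_itv/= andbT => t0; rewrite derive1E.
    by case: (der t t0).
move: int_g; rewrite /g RintegralD//; last first.
  exact: integrable_EFinB.
rewrite RintegralB// int_e RintegralZl//; last exact: integrable_euler_closed.
rewrite -!euler_integral_closed//; lra.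
Qed.

Lemma euler_integral_log_convex a : 0 <= a ->
  euler_integral (a + 2^-1) ^+ 2 <= euler_integral a * euler_integral (a + 1).
Proof.
move=> a0; apply: nonneg_form_discriminant => x y.
have ah : 0 <= a + 2^-1 by lra.
have a1 : 0 <= a + 1 by lra.
have scale b c : 0 <= b -> c * euler_integral b =
    \int[mu]_(t in `]0, +oo[) (c * euler b t).
  by move=> b0; rewrite RintegralZl//; exact: integrable_euler.
have ic b c : 0 <= b -> mu.-integrable `]0, +oo[ (EFin \o (fun t => c * euler b t)).
  by move=> b0; apply: integrable_scale => //; exact: integrable_euler.
rewrite !scale// -!RintegralD//; try (apply: ic => //).
  apply: Rintegral_ge0 => t; rewrite /= in_itv/= andbT => t0.
  rewrite (_ : _ + _ = euler a t * (x + y * t `^ 2^-1) ^+ 2).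
    by rewrite mulr_ge0 ?euler_ge0 ?sqr_ge0.
  rewrite /euler (_ : a + 1 = a + 2^-1 + 2^-1); last by field.
  have key (A S E : R) : x ^+ 2 * (A * E) + 2 * x * y * (A * S * E)
      + y ^+ 2 * (A * S * S * E) = A * E * (x + y * S) ^+ 2 by ring.
  by rewrite !powRD ?gt_eqF ?implybT//; (try lra); exact: (key (powR t a) (powR t 2^-1)).
by apply: (@integrable_EFinD _ (fun t => x ^+ 2 * euler a t)
  (fun t => 2 * x * y * euler (a + 2^-1) t)) => //; apply: ic.
Qed.
End EulerIntegral.

(** * The properties of Gamma(1 + q/2) that determine the moment limits *)

Section GammaFacts.
Variable R : realType.
Local Notation G q := (Gamma (1 + q%:R / 2 : R)).

Lemma GammaE (q : nat) : G q = Rintegral (@lebesgue_measure R) `]0, +oo[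
  (fun t => t `^ (q%:R / 2) * expR (- t)).
Proof. by rewrite /Gamma addrAC subrr add0r. Qed.

Lemma Gamma_half0 : G 0%N = 1.
Proof. by rewrite GammaE mul0r euler_integral0. Qed.

Lemma Gamma_half_rec k : G k.+2 = (1 + k%:R / 2) * G k.
Proof.
rewrite !GammaE (_ : k.+2%:R / 2 = k%:R / 2 + 1); last by rewrite -addn2 natrD; field.
by rewrite euler_integral_rec ?divr_ge0// [1 + _]addrC.
Qed.

Lemma Gamma_half_log_convex k : G k.+1 ^+ 2 <= G k * G k.+2.
Proof.
rewrite !GammaE (_ : k.+2%:R / 2 = k%:R / 2 + 1); last by rewrite -addn2 natrD; field.
rewrite (_ : k.+1%:R / 2 = k%:R / 2 + 2^-1); last by rewrite -addn1 natrD; field.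
by apply: euler_integral_log_convex; rewrite divr_ge0.
Qed.

(** Were Gamma(3/2) zero, log-convexity would force Gamma(2) = 1 to vanish. *)
Lemma Gamma_half1_gt0 : 0 < G 1%N.
Proof.
have G1 : 0 <= G 1%N by rewrite GammaE euler_integral_ge0.
rewrite lt_neqAle G1 andbT eq_sym; apply/eqP => G10.
have := Gamma_half_log_convex 1; rewrite G10 mul0r Gamma_half_rec Gamma_half0.
by rewrite mul0r addr0 mulr1 expr1n ler10.
Qed.
End GammaFacts.

(** * Sampling at roots of unity *)

Section ComplexModulus.
Variable R : realType.
Implicit Types u v : R[i].
Local Notation Re := (@complex.Re R).
Local Notation Im := (@complex.Im R).

Lemma rnorm_sqr u : rnorm u ^+ 2 = Re u ^+ 2 + Im u ^+ 2.
Proof. by apply: (@complexI R); rewrite rmorphXn /= rnormE -add_Re2_Im2. Qed.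

Lemma rnormM u v : rnorm (u * v) = rnorm u * rnorm v.
Proof. by apply: (@complexI R); rewrite rmorphM /= !rnormE normrM. Qed.

Lemma rnormX u k : rnorm (u ^+ k) = rnorm u ^+ k.
Proof. by apply: (@complexI R); rewrite rmorphXn /= !rnormE normrX. Qed.

Lemma rnormD_le (V : normedZmodType R[i]) (x y : V) : rnorm (x + y) <= rnorm x + rnorm y.
Proof. by rewrite le_rnorm rmorphD /= !rnormE ler_normD. Qed.

Lemma rnorm_sum_le (I : finType) (P : pred I) (F : I -> R[i]) :
  rnorm (\sum_(i | P i) F i) <= \sum_(i | P i) rnorm (F i).
Proof.
rewrite le_rnorm (le_trans (ler_norm_sum _ _ _))// rmorph_sum /=.
by apply: ler_sum => i _; rewrite rnormE.
Qed.

Lemma rnormN (V : normedZmodType R[i]) (x : V) : rnorm (- x) = rnorm x.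
Proof. by rewrite /rnorm normrN. Qed.

Lemma rnorm_conj u : rnorm (conjc u) = rnorm u.
Proof. by apply: (@complexI R); rewrite !rnormE normcJ. Qed.

Lemma rnorm_real (x : R) : rnorm (x%:C)%C = `|x|.
Proof.
apply/eqP; rewrite -(eqrXn2 (n := 2)) ?rnorm_ge0//.
by rewrite rnorm_sqr /= expr0n addr0 real_normK ?num_real.
Qed.

Lemma Re_le_rnorm u : `|Re u| <= rnorm u.
Proof. by rewrite -lecR rnormE normc_ge_Re. Qed.

Lemma rnormD_sqr u v :
  rnorm (u + v) ^+ 2 = rnorm u ^+ 2 + 2 * Re (conjc u * v) + rnorm v ^+ 2.
Proof. by rewrite !rnorm_sqr; case: u v => [a b] [c e] /=; ring. Qed.

Lemma conjc_mul_self u : conjc u * u = ((rnorm u ^+ 2)%:C)%C.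
Proof. by rewrite rmorphXn /= rnormE sqr_normc mulrC. Qed.

Lemma Re_nat k : Re (k%:R : R[i]) = k%:R.
Proof. by elim: k => // k IH; rewrite -!natr1 -IH; case: (k%:R). Qed.

(** The double-angle formula; it brings the clause [uw_tt] into the form of a vanishing mean of a
    square. *)
Lemma Re_sqr_unit u v : rnorm v = 1 ->
  2 * Re (conjc u * v) ^+ 2 - rnorm u ^+ 2 = Re ((conjc u * v) ^+ 2).
Proof.
move=> v1; have -> : rnorm u ^+ 2 = rnorm (conjc u * v) ^+ 2.
  by rewrite rnormM rnorm_conj v1 mulr1.
by rewrite rnorm_sqr; case: (conjc u * v) => a b /=; ring.
Qed.

(** The polynomial X^N - 1 splits over [R[i]] and is separable, so it has N distinct roots, and N
    distinct N-th roots of unity include a primitive one. *)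
Lemma prim_root_exists N : (0 < N)%N -> exists z : R[i], N.-primitive_root z.
Proof.
pose p : {poly R[i]} := 'X^N - 1; have [r Dp] := closed_field_poly_normal p.
move=> N_gt0; rewrite (monicP _) ?monicXnsubC // scale1r in Dp.
have rn1 : all N.-unity_root r by apply/allP=> z; rewrite -root_prod_XsubC -Dp.
have sz_r : (N < (size r).+1)%N.
  by rewrite -(size_prod_XsubC r id) -Dp size_XnsubC.
have [|z] := hasP (has_prim_root N_gt0 rn1 _ sz_r); last by exists z.
by rewrite -separable_prod_XsubC -Dp separable_Xn_sub_1 // pnatr_eq0 -lt0n.
Qed.

Lemma prim_root_rnorm N (z : R[i]) : N.-primitive_root z -> rnorm z = 1.
Proof.
move=> zP; have N0 := prim_order_gt0 zP.
have : rnorm z ^+ N == 1 by rewrite -rnormX (prim_expr_order zP) rnorm_real normr1.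
by rewrite pexprn_eq1 ?rnorm_ge0// eqn0Ngt N0 => /eqP.
Qed.

Lemma avg_real_complex (W : finType) (f : W -> R) :
  (avg f)%:C%C = avg (fun w => (f w)%:C%C).
Proof. by rewrite /avg rmorphM fmorphV rmorph_nat rmorph_sum. Qed.

Lemma Re_avg (W : finType) (f : W -> R[i]) : Re (avg f) = avg (Re \o f).
Proof.
rewrite /avg (_ : (#|W|%:R : R[i])^-1 = ((#|W|%:R^-1 : R)%:C)%C); last first.
  by rewrite fmorphV rmorph_nat.
transitivity (Re (\sum_w f w) * #|W|%:R^-1).
  by case: (\sum_w f w) => a b /=; rewrite mulr0 subr0.
by congr (_ * _); rewrite raddf_sum.
Qed.
End ComplexModulus.

(** * Sums of independent roots of unity as unimodular walks *)

Section RootSampling.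
Variables (R : realType) (n N : nat) (zeta : R[i]).
Hypothesis zetaP : N.-primitive_root zeta.
Local Notation W := {ffun 'I_n -> 'I_N}.

Definition root_pt (w : W) (i : 'I_n) : R[i] := zeta ^+ (w i).

Definition shift (j : 'I_n) (w : W) : W :=
  [ffun i => if i == j then ordS (w i) else w i].

Lemma shift_inj j : injective (shift j).
Proof.
move=> w1 w2 /ffunP eqw; apply/ffunP => i; have := eqw i.
by rewrite !ffunE; case: ifP => // _; exact: ordS_inj.
Qed.

Lemma root_pt_shift j w i :
  root_pt (shift j w) i = if i == j then zeta * root_pt w i else root_pt w i.
Proof.
rewrite /root_pt ffunE; case: ifP => // _ /=.
by rewrite (prim_expr_mod zetaP) exprS.
Qed.

Lemma root_pt_rnorm w i : rnorm (root_pt w i) = 1.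
Proof. by rewrite /root_pt rnormX (prim_root_rnorm zetaP) expr1n. Qed.

Lemma card_root_gt0 : (0 < #|W|)%N.
Proof. by rewrite card_ffun !card_ord expn_gt0 (prim_order_gt0 zetaP). Qed.

(** [shift j] permutes the sample points, so [avg f = c * avg f]. This takes the place of
    independence and of integration over one coordinate. *)
Lemma avg_shift0 j c (f : W -> R[i]) : c != 1 ->
  (forall w, f (shift j w) = c * f w) -> avg f = 0.
Proof.
move=> c1 fc; apply/eqP; have : avg f = c * avg f.
  rewrite -avgZ -(eq_avg fc) /avg; congr (_ / _).
  by rewrite (reindex_inj (@shift_inj j)).
move/eqP; rewrite -subr_eq0 -{1}[avg f]mul1r -mulrBl mulf_eq0 subr_eq0 eq_sym.
by rewrite (negPf c1).
Qed.

Variable z : 'I_n -> R[i].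
Hypothesis z1 : forall i, rnorm (z i) = 1.

Let S w := \sum_i z i * root_pt w i.
Let a j w := \sum_(i | i != j) z i * root_pt w i.

(** Turning coordinate [j] alone fixes [a j] and multiplies [x j] by [zeta]. Hence the first and
    second powers of [conjc (a j) * x j] have mean zero against any function of [rnorm (a j)];
    [2 < N] makes [zeta] and its square differ from 1. *)
Lemma steinhaus_walk : (2 < N)%N ->
  exists r t : 'I_n -> W -> R, unimodular_walk (fun w => rnorm (S w)) r t.
Proof.
move=> N3; pose x j w := z j * root_pt w j.
have x1 j w : rnorm (x j w) = 1 by rewrite rnormM z1 root_pt_rnorm mulr1.
have Sa j w : S w = a j w + x j w by rewrite /S (bigD1 j)//= addrC.
have a_shift j w : a j (shift j w) = a j w.
  by apply: eq_bigr => i ij; rewrite root_pt_shift (negPf ij).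
have x_shift j w : x j (shift j w) = zeta * x j w.
  by rewrite /x root_pt_shift eqxx mulrCA.
exists (fun j w => rnorm (a j w)), (fun j w => complex.Re (conjc (a j w) * x j w)).
have zeta_neq1 k : (0 < k < 3)%N -> zeta ^+ k != 1.
  move=> /andP[k0 k3]; rewrite -(prim_order_dvd zetaP).
  by apply/negP => /dvdn_leq => /(_ k0); lia.
have avg0 j (g : R -> R) k : (0 < k < 3)%N ->
    avg (fun w => complex.Re ((conjc (a j w) * x j w) ^+ k) * g (rnorm (a j w))) = 0.
  move=> k03.
  transitivity (complex.Re (avg (fun w =>
      (conjc (a j w) * x j w) ^+ k * ((g (rnorm (a j w)))%:C)%C))).
    rewrite Re_avg; apply: eq_avg => w /=.
    by case: (_ ^+ k) => b c /=; rewrite mulr0 subr0.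
  rewrite (@avg_shift0 j (zeta ^+ k)) ?zeta_neq1// => w.
  by rewrite a_shift x_shift mulrCA exprMn mulrA.
split.
- exact: card_root_gt0.
- by move=> w; exact: rnorm_ge0.
- by move=> j w; exact: rnorm_ge0.
- move=> j w; apply: le_trans (Re_le_rnorm _) _.
  by rewrite rnormM rnorm_conj x1 mulr1.
- move=> j w; rewrite ler_distl; apply/andP; split.
    rewrite lerBlDr -[X in _ + X](x1 j w) -(rnormN (x j w)).
    by rewrite -[a j w](addrK (x j w)) -Sa rnormD_le.
  by rewrite -[X in _ + X](x1 j w) (Sa j) rnormD_le.
- by move=> j w; rewrite (Sa j) rnormD_sqr x1 expr1n.
- move=> w; transitivity (complex.Re (conjc (S w) * S w)); last first.
    by rewrite conjc_mul_self.
  rewrite {2}/S big_distrr raddf_sum; apply: eq_bigr => j _ /=.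
  rewrite -/(x j w) (Sa j w) raddfD mulrDl raddfD /= conjc_mul_self x1 expr1n.
  by rewrite addrC.
- move=> j g; rewrite -[RHS](avg0 j g 1)//; apply: eq_avg => w.
- move=> j g; rewrite -[RHS](avg0 j g 2)//; apply: eq_avg => w.
  by rewrite Re_sqr_unit.
Qed.

End RootSampling.

(** * Homogeneous polynomials on the torus *)

Local Notation is_homog d := (ishomog1 d (@mdeg _)).

Section Monomials.
Variables (R : realType) (n : nat).
Implicit Types (v : 'I_n -> R[i]) (p q : mpoly n R[i]) (m : multinom n).

Definition mono v m : R[i] := \prod_i v i ^+ m i.

Lemma meval_mono v m : meval v (mpolyX R[i] m) = mono v m.
Proof. by rewrite mevalX. Qed.

(** [bmultinom n k] is the finite type of exponents of degree less than [k]; degree [d] therefore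
    calls for [k = d.+1]. *)
Lemma meval_coef v p k : (msize p <= k)%N ->
  meval v p = \sum_(m : bmultinom n k) mcoeff m p * mono v m.
Proof.
move=> pk; rewrite {1}(mpolywE pk) raddf_sum; apply: eq_bigr => m _ /=.
by rewrite mevalZ meval_mono.
Qed.

Lemma msize_homog d p : p \is is_homog d -> (msize p <= d.+1)%N.
Proof.
move=> /dhomogP pd; rewrite msizeE big_seq; apply/bigmax_leqP_seq => m mp _.
by rewrite pd.
Qed.

Lemma mono_rnorm1 v m : (forall i, rnorm (v i) = 1) -> rnorm (mono v m) = 1.
Proof.
move=> v1; rewrite /mono; elim/big_ind: _ => [|x y x1 y1|i _].
- by rewrite rnorm_real normr1.
- by rewrite rnormM x1 y1 mulr1.
- by rewrite rnormX v1 expr1n.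
Qed.

Lemma mono_rnorm_le1 v m : (forall i, rnorm (v i) <= 1) -> rnorm (mono v m) <= 1.
Proof.
move=> v1; rewrite /mono; elim/big_ind: _ => [|x y x1 y1|i _].
- by rewrite rnorm_real normr1.
- by rewrite rnormM mulr_ile1 ?rnorm_ge0.
- by rewrite rnormX exprn_ile1 ?rnorm_ge0.
Qed.

Lemma monoM u v m : mono (fun i => u i * v i) m = mono u m * mono v m.
Proof. by rewrite /mono -big_split; apply: eq_bigr => i _; rewrite exprMn. Qed.

Lemma mono_conj v m : mono (fun i => conjc (v i)) m = conjc (mono v m).
Proof. by rewrite /mono rmorph_prod; apply: eq_bigr => i _; rewrite rmorphXn. Qed.

Lemma card_bmultinom_le k : (#|{: bmultinom n k}| <= k ^ n)%N.
Proof.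
rewrite -[X in (_ <= _ ^ X)%N]card_ord -[X in (_ <= X ^ _)%N]card_ord -card_ffun.
have lt (m : bmultinom n k) i : (m i < k)%N.
  apply: leq_ltn_trans (bmdeg m).
  by rewrite mdegE (bigD1 i) //= leq_addr.
pose f (m : bmultinom n k) : {ffun 'I_n -> 'I_k} := [ffun i => Ordinal (lt m i)].
apply: (@leq_card _ _ f) => m1 m2 /ffunP e12.
apply: val_inj; apply/mnmP => i; have := e12 i; rewrite !ffunE.
by move=> /(congr1 val).
Qed.
End Monomials.

(** * Discrete Fourier analysis of polynomials on roots of unity *)

Section RootOrthogonality.
Variables (R : realType) (n N : nat) (zeta : R[i]).
Hypothesis zetaP : N.-primitive_root zeta.
Implicit Types (p : mpoly n R[i]) (m : multinom n).
Local Notation W := {ffun 'I_n -> 'I_N}.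
Local Notation xi := (@root_pt R n N zeta).

Lemma mono_shift j (w : W) m :
  mono (xi (shift j w)) m = zeta ^+ m j * mono (xi w) m.
Proof.
rewrite /mono (bigD1 j)//= [in RHS](bigD1 j)//= mulrA; congr (_ * _).
  by rewrite root_pt_shift// eqxx exprMn.
by apply: eq_bigr => i ij; rewrite root_pt_shift// (negPf ij).
Qed.

(** Distinct exponents differ at some [j], and remain distinct modulo [N] because both are below
    [N]. Shifting coordinate [j] then multiplies the product by a number other than 1. *)
Lemma mono_orthogonal m m' : (mdeg m < N)%N -> (mdeg m' < N)%N ->
  avg (fun w : W => mono (xi w) m * conjc (mono (xi w) m')) = (m == m')%:R.
Proof.
move=> mN m'N; have [->|mm'] := eqVneq m m'.
  rewrite (@eq_avg _ _ _ (fun=> 1)) ?(avg_cst _ (card_root_gt0 _ zetaP))// => w.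
  by rewrite mulrC conjc_mul_self mono_rnorm1 ?expr1n// => i; exact: (root_pt_rnorm zetaP).
have [j mj] : exists j, m j != m' j.
  apply/existsP; rewrite -negb_forall; apply: contra mm' => /forallP e.
  by apply/eqP/mnmP => j; apply/eqP.
have lt (k : multinom n) : (mdeg k < N)%N -> (k j < N)%N.
  by apply: leq_ltn_trans; rewrite mdegE (bigD1 j) //= leq_addr.
rewrite -[RHS]/(0 : R[i]).
apply: (@avg_shift0 _ _ _ j (zeta ^+ m j * conjc (zeta ^+ m' j))).
  apply: contra mj => /eqP e.
  have e' : zeta ^+ m j = zeta ^+ m' j.
    rewrite -[RHS]mul1r -e -mulrA conjc_mul_self rnormX (prim_root_rnorm zetaP).
    by rewrite !expr1n mulr1.
  by move/eqP: e'; rewrite (eq_prim_root_expr zetaP) !modn_small ?lt.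
by move=> w; rewrite !mono_shift rmorphM /=; ring.
Qed.

Lemma mcoeff_avg p m : (msize p <= N)%N -> (mdeg m < N)%N ->
  avg (fun w : W => meval (xi w) p * conjc (mono (xi w) m)) = mcoeff m p.
Proof.
move=> pN mN.
transitivity (avg (fun w : W => \sum_(k : bmultinom n N)
    mcoeff k p * (mono (xi w) k * conjc (mono (xi w) m)))).
  apply: eq_avg => w; rewrite (meval_coef _ pN) mulr_suml.
  by apply: eq_bigr => k _; rewrite mulrA.
rewrite avg_sum (bigD1 (BMultinom mN))//= avgZ mono_orthogonal// eqxx mulr1.
rewrite big1 ?addr0// => k km; rewrite avgZ mono_orthogonal ?bmdeg//.
case: eqP => [e|]; last by rewrite mulr0.
by case/eqP: km; apply: val_inj.
Qed.

Lemma rnorm_avg_le (W' : finType) (f : W' -> R[i]) :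
  rnorm (avg f) <= avg (fun w => rnorm (f w)).
Proof.
rewrite le_rnorm (le_trans (ler_norm_avg _))// avg_real_complex.
by apply: avg_le => w; rewrite rnormE.
Qed.

(** Cauchy's estimate, read off from the discrete Fourier formula for the coefficients. *)
Lemma rnorm_mcoeff_le p m M : (0 < N)%N -> (msize p <= N)%N ->
  (forall v, (forall i, rnorm (v i) = 1) -> rnorm (meval v p) <= M) ->
  rnorm (mcoeff m p) <= M.
Proof.
move=> N0 pN pM; have W0 := card_root_gt0 n zetaP.
have M0 : 0 <= M.
  by apply: le_trans (rnorm_ge0 _) (pM (fun=> 1) _) => i; rewrite rnorm_real normr1.
have [mN|Nm] := ltnP (mdeg m) N; last first.
  have : m \notin msupp p by apply: msize_mdeg_ge; exact: leq_trans Nm.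
  by rewrite -mcoeff_eq0 => /eqP ->; rewrite rnorm_real normr0.
rewrite -(mcoeff_avg pN mN) (le_trans (rnorm_avg_le _))//.
rewrite -[leRHS](avg_cst _ W0); apply: avg_le => w.
rewrite rnormM rnorm_conj [X in _ * X]mono_rnorm1 ?mulr1; last first.
  by move=> i; exact: (root_pt_rnorm zetaP).
by apply: pM => i; exact: (root_pt_rnorm zetaP).
Qed.
End RootOrthogonality.

(** * Comparison of exponential and polynomial growth *)

Section MaximumModulus.
Variable R : realType.

Lemma bernoulli_le (x : R) l : 0 <= x -> 1 + l%:R * x <= (1 + x) ^+ l.
Proof.
move=> x0; elim: l => [|l IH]; first by rewrite mul0r addr0 expr0.
rewrite exprS; apply: le_trans (ler_wpM2l _ IH); last by lra.
by rewrite -natr1; have := ler0n R l; nra.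
Qed.

(** If [x > M > 0], the ratio is [1 + e] with [e > 0], and its powers outgrow every polynomial. *)
Lemma le_of_power_growth (x M : R) (D n : nat) : 0 <= x -> 0 <= M ->
  (forall k, x ^+ k <= ((D * k).+1 ^ n)%:R * M ^+ k) -> x <= M.
Proof.
move=> x0 M0 H; have [//|Mx] := leP x M.
have [M00|Mn0] := eqVneq M 0.
  by have := H 1%N; rewrite M00 !expr1 mulr0 -M00 leNgt Mx.
have Mgt0 : 0 < M by rewrite lt_neqAle eq_sym Mn0.
pose e := x / M - 1.
have e0 : 0 < e by rewrite subr_gt0 ltr_pdivlMr// mul1r.
have {}H k : (1 + e) ^+ k <= ((D * k).+1 ^ n)%:R.
  by rewrite /e addrC subrK expr_div_n ler_pdivrMr ?exprn_gt0// H.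
(* Take [k = l * n.+1]. The polynomial factor is at most [(A * l) ^ n], and Bernoulli gives
   [(1 + e) ^+ l >= l * e], so [l * e ^+ n.+1 <= A ^ n]; the choice of [l] excludes this. *)
pose A := (D * n.+1).+1.
pose l := (Num.truncn ((A ^ n)%:R / e ^+ n.+1)).+1.
have l_gt : (A ^ n)%:R / e ^+ n.+1 < l%:R by exact: truncnS_gt.
have H1 : (l%:R * e) ^+ n.+1 <= l%:R ^+ n * (A ^ n)%:R.
  have H2 := H (l * n.+1)%N; rewrite exprM in H2.
  apply: le_trans (le_trans _ H2) _.
    have le1 : l%:R * e <= (1 + e) ^+ l.
      by rewrite (le_trans _ (bernoulli_le l (ltW e0)))// lerDr.
    apply: lerXn2r le1; rewrite nnegrE; [by rewrite mulr_ge0 ?(ltW e0) | apply: exprn_ge0; lra].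
  rewrite -natrX -natrM -expnMn ler_nat.
  have [->|n0] := posnP n; first by rewrite !expn0.
  by rewrite leq_exp2r// /A /l; nia.
move: H1; rewrite exprMn exprSr -mulrA ler_pM2l ?exprn_gt0 ?ltr0n//.
by rewrite -ler_pdivlMr ?exprn_gt0// leNgt l_gt.
Qed.
End MaximumModulus.

(** * The sup norm in terms of the torus and of the coefficients *)

Section PolydiscNorm.
Variables (R : realType) (n d : nat).
Implicit Types (p : homog_poly R n d).

(* The coefficients of [p ^+ k] are at most [M ^+ k] and there are only
   polynomially many of them in [k]; take k-th roots. *)
Lemma max_modulus (p : mpoly n R[i]) (M : R) (v : 'I_n -> R[i]) :
  p \is is_homog d ->
  (forall u, (forall i, rnorm (u i) = 1) -> rnorm (meval u p) <= M) ->
  (forall i, rnorm (v i) <= 1) -> rnorm (meval v p) <= M.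
Proof.
move=> pd pM v1.
have M0 : 0 <= M.
  by apply: le_trans (rnorm_ge0 _) (pM (fun=> 1) _) => i; rewrite rnorm_real normr1.
apply: (le_of_power_growth (D := d) (n := n)) => //; first exact: rnorm_ge0.
move=> k; have pk : p ^+ k \is is_homog (d * k) by exact: dhomogMn.
have pks := msize_homog pk.
have [zeta zetaP] := @prim_root_exists R (d * k).+1 isT.
rewrite -rnormX -rmorphXn /= (meval_coef _ pks).
apply: (le_trans (rnorm_sum_le _ _)).
apply: (@le_trans _ _ (\sum_(m : bmultinom n (d * k).+1) M ^+ k)).
  apply: ler_sum => m _; rewrite rnormM -[leRHS]mulr1 ler_pM ?rnorm_ge0 ?mono_rnorm_le1//.
  apply: (rnorm_mcoeff_le zetaP) => // u u1.
  by rewrite rmorphXn rnormX lerXn2r ?nnegrE ?rnorm_ge0// pM.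
rewrite sumr_const -[leLHS]mulr_natl ler_wpM2r ?exprn_ge0// ler_nat.
exact: card_bmultinom_le.
Qed.

Lemma norm_rV_le1 (z : 'rV[R[i]]_n) :
  (`|z| <= 1) <-> (forall i, rnorm (z ord0 i) <= 1).
Proof.
split=> [z1 i|z1].
  by rewrite le_rnorm (le_trans (coord_le_norm z i)).
rewrite -[`|z|]/(mx_norm z).
have [->|/mx_norm_neq0[[i j] ->]] := eqVneq (mx_norm z) 0; first exact: ler01.
by rewrite /= ord1 -le_rnorm z1.
Qed.

Lemma homog_poly_norm_le_torus p (M : R) :
  (forall u, (forall i, rnorm (u i) = 1) -> rnorm (meval u (mpoly_of_dhomog p)) <= M) ->
  rnorm p <= M.
Proof.
move=> pM; rewrite homog_poly_normE; apply: homog_poly_norm_le => z /norm_rV_le1 z1.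
exact: (max_modulus (dhomog_is_dhomog p)).
Qed.

Lemma homog_poly_norm_eval p (v : 'I_n -> R[i]) : (forall i, rnorm (v i) <= 1) ->
  rnorm (meval v (mpoly_of_dhomog p)) <= rnorm p.
Proof.
move=> v1; rewrite homog_poly_normE.
have := @homog_poly_norm_ub R n d p (\row_i v i).
rewrite /homog_poly_eval (@meval_eq _ _ _ v).
  by apply; apply/norm_rV_le1 => i; rewrite mxE.
by move=> i; rewrite mxE.
Qed.

Lemma homog_poly_norm_mcoeff p m : rnorm (mcoeff m (mpoly_of_dhomog p)) <= rnorm p.
Proof.
have [zeta zetaP] := @prim_root_exists R d.+1 isT.
apply: (rnorm_mcoeff_le zetaP) => //; first exact: msize_homog (dhomog_is_dhomog p).
by move=> v v1; apply: homog_poly_norm_eval => i; rewrite v1.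
Qed.

Lemma homog_poly_norm_le_sum p : rnorm p <=
  \sum_(m : bmultinom n d.+1) rnorm (mcoeff m (mpoly_of_dhomog p)).
Proof.
apply: homog_poly_norm_le_torus => u u1.
rewrite (meval_coef _ (msize_homog (dhomog_is_dhomog p))).
rewrite (le_trans (rnorm_sum_le _ _))//; apply: ler_sum => m _.
by rewrite rnormM mono_rnorm1 ?mulr1.
Qed.

Definition homog_poly_of_coef (c : multinom n -> R[i]) : homog_poly R n d :=
  \sum_(m : bmultinom n d.+1 | mdeg m == d) c m *: indhomog d (mpolyX R[i] m).

Lemma mpoly_of_coef (c : multinom n -> R[i]) :
  mpoly_of_dhomog (homog_poly_of_coef c) =
  \sum_(m : bmultinom n d.+1 | mdeg m == d) c m *: mpolyX R[i] m.
Proof.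
rewrite /homog_poly_of_coef raddf_sum /=; apply: eq_bigr => m md.
transitivity (c m *: mpoly_of_dhomog (indhomog d (mpolyX R[i] m))) => //.
congr (_ *: _).
by rewrite /indhomog val_insubd dhomogX md.
Qed.

Lemma mcoeff_of_coef c (m : multinom n) :
  mcoeff m (mpoly_of_dhomog (homog_poly_of_coef c)) = if mdeg m == d then c m else 0.
Proof.
rewrite mpoly_of_coef raddf_sum /=; case: ifP => md; last first.
  apply: big1 => k kd; rewrite mcoeffZ mcoeffX; case: eqP => [e|]; last by rewrite mulr0.
  by rewrite -e kd in md.
have mS : (mdeg m < d.+1)%N by rewrite (eqP md).
rewrite (bigD1 (BMultinom mS))//= mcoeffZ mcoeffX eqxx mulr1 big1 ?addr0//.
move=> k /andP[kd km]; rewrite mcoeffZ mcoeffX; case: eqP => [e|]; last by rewrite mulr0.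
by case/eqP: km; apply: val_inj.
Qed.

Lemma mcoeff_homog0 p (m : multinom n) : mdeg m != d ->
  mcoeff m (mpoly_of_dhomog p) = 0.
Proof. by move=> md; exact: (dhomog_nemf_coeff (dhomog_is_dhomog p)). Qed.
End PolydiscNorm.

(** * Completeness of the spaces of homogeneous polynomials *)

Section HomogPolyComplete.
Variables (R : realType) (n d : nat).
Local Notation X := (homog_poly R n d).
Local Notation coef m p := (mcoeff m (mpoly_of_dhomog (p : X))).

Lemma rnorm_le_ReIm (u : R[i]) : rnorm u <= `|complex.Re u| + `|complex.Im u|.
Proof.
rewrite -ler_sqr ?nnegrE ?rnorm_ge0 ?addr_ge0// rnorm_sqr sqrrD !real_normK ?num_real//.
by rewrite lerD2r lerDl mulrn_wge0// mulr_ge0.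
Qed.

Lemma Im_le_rnorm (u : R[i]) : `|complex.Im u| <= rnorm u.
Proof.
rewrite -ler_sqr ?nnegrE ?rnorm_ge0// rnorm_sqr real_normK ?num_real//.
by rewrite lerDr sqr_ge0.
Qed.

Lemma contraction_cauchy (f : X -> R) (F : set_system X) : ProperFilter F ->
  (forall p q, `|f p - f q| <= rnorm (p - q)) -> cauchy F -> cvg (f @ F).
Proof.
move=> FF fle Fc; apply: cauchy_cvg; apply/cauchyP => e e0.
have e0C : (0 : R[i]) < e%:C%C by rewrite ltcR.
have /cauchyP/(_ _ e0C)[p Fp] := Fc; exists (f p).
have sub : ball p e%:C%C `<=` f @^-1` ball (f p) e.
  move=> q; rewrite /= -!ball_normE /= => pq.
  by apply: le_lt_trans (fle p q) _; rewrite -ltcR rnormE.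
exact: filterS sub Fp.
Qed.

(** Real and imaginary parts of each coefficient are 1-Lipschitz, so they converge along [F], and
    finitely many coefficients control the norm. Completeness admits such spaces as superspaces in
    the definition of [projection_constant]. *)
Lemma homog_poly_complete (F : set_system X) :
  ProperFilter F -> cauchy F -> cvg F.
Proof.
move=> FF Fc.
have coefB m (p q : X) : coef m (p - q) = coef m p - coef m q.
  exact: mcoeffB.
have ReC m : cvg ((fun p : X => complex.Re (coef m p)) @ F).
  apply: contraction_cauchy Fc => p q.
  rewrite -raddfB /= -coefB (le_trans (Re_le_rnorm _))//.
  exact: homog_poly_norm_mcoeff.
have ImC m : cvg ((fun p : X => complex.Im (coef m p)) @ F).
  apply: contraction_cauchy Fc => p q.
  rewrite -raddfB /= -coefB (le_trans (Im_le_rnorm _))//.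
  exact: homog_poly_norm_mcoeff.
pose c m : R[i] := Complex (lim ((fun p : X => complex.Re (coef m p)) @ F))
  (lim ((fun p : X => complex.Im (coef m p)) @ F)).
pose q : X := homog_poly_of_coef d c.
apply/cvg_ex; exists q; apply/cvgrPdist_le => /= e e0.
have [eR eE] : {r : R | e = r%:C%C}.
  by exists (complex.Re e); rewrite RRe_real// gtr0_real.
have eR0 : 0 < eR by rewrite eE ltcR in e0.
pose K := (#|{: bmultinom n d.+1}|).+1.
have dlt : 0 < eR / 2 / K%:R by rewrite !divr_gt0// ltr0n.
have near_coef (m : bmultinom n d.+1) :
    \forall p \near F, rnorm (coef m (q - p)) <= eR / K%:R.
  have [md|md] := eqVneq (mdeg m) d; last first.
    apply: filterE => p; rewrite mcoeff_homog0// rnorm_real normr0.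
    by rewrite divr_ge0// ltW.
  have /cvgrPdist_le/(_ _ dlt) H1 := ReC m.
  have /cvgrPdist_le/(_ _ dlt) H2 := ImC m.
  apply: filterS2 H1 H2 => p h1 h2; rewrite coefB mcoeff_of_coef md eqxx.
  rewrite (le_trans (rnorm_le_ReIm _))//.
  have -> : eR / K%:R = eR / 2 / K%:R + eR / 2 / K%:R by rewrite -mulrDl -splitr.
  by rewrite !raddfB /=; apply: lerD.
apply: filterS (filter_forall _ near_coef) => p pH.
rewrite eE -le_rnorm (le_trans (homog_poly_norm_le_sum _))//.
apply: (@le_trans _ _ (\sum_(m : bmultinom n d.+1) eR / K%:R)).
  by apply: ler_sum => m _; exact: pH.
rewrite sumr_const -[leLHS]mulr_natr mulrAC ler_pdivrMr ?ltr0n//.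
by rewrite ler_wpM2l ?(ltW eR0)// ler_nat.
Qed.
End HomogPolyComplete.

HB.instance Definition _ (R : realType) (n d : nat) :=
  Uniform_isComplete.Build (homog_poly R n d) (@homog_poly_complete R n d).

(** * Complex Hahn-Banach extension *)

Section HahnBanach.
Variables (R : realType) (Y : normedModType R[i]).
Implicit Types (G : set (Y * R)) (x y : Y) (a b r : R).

(* Such a [G] is automatically the graph of a function: if it contains [(0, a)],
   it contains [(0, - a)] too, so [a <= 0] and [- a <= 0]. *)
Definition dominated_graph G : Prop :=
  (forall r y1 a1 y2 a2, G (y1, a1) -> G (y2, a2) ->
     G (r%:C%C *: y1 + y2, r * a1 + a2)) /\
  (forall y a, G (y, a) -> a <= rnorm y).

Lemma rnormZ_real r y : rnorm (r%:C%C *: y) = `|r| * rnorm y.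
Proof.
apply: (@complexI R); rewrite rmorphM /= !rnormE normrZ; congr (_ * _).
by rewrite -rnormE rnorm_real.
Qed.

(** The value [c] at [y0] must lie between all [a - rnorm (y - y0)] and all [rnorm (y + y0) - a].
    The triangle inequality puts the former below the latter, and the supremum of the former
    serves. *)
Lemma graph_extension G y0 : G (0, 0) -> dominated_graph G ->
  exists c, dominated_graph
    [set q | exists r y a, G (y, a) /\ q = (r%:C%C *: y0 + y, r * c + a)].
Proof.
move=> G0 [Glin Gdom].
have Gadd y1 a1 y2 a2 : G (y1, a1) -> G (y2, a2) -> G (y1 + y2, a1 + a2).
  by move=> g1 g2; have := Glin 1 _ _ _ _ g1 g2; rewrite scale1r mul1r.
have Gscale r y a : G (y, a) -> G (r%:C%C *: y, r * a).
  by move=> g; have := Glin r _ _ _ _ g G0; rewrite !addr0.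
pose A := [set q.2 - rnorm (q.1 - y0) | q in G].
have Aub q : G q -> ubound A (rnorm (q.1 + y0) - q.2).
  case: q => y a /= g _ [[y' a'] /= g' <-].
  rewrite lerBrDr addrAC lerBlDr (le_trans (Gdom _ _ (Gadd _ _ _ _ g' g)))//.
  by rewrite -{1}[y'](subrK y0) -addrA [y0 + y]addrC addrC rnormD_le.
have A0 : has_sup A.
  split; first by exists (0 - rnorm (0 - y0)), (0, 0).
  by exists (rnorm (0 + y0) - 0); exact: (Aub (0, 0)).
pose c := sup A; exists c.
have c_ge y a : G (y, a) -> a - rnorm (y - y0) <= c.
  by move=> g; apply: ub_le_sup; [exact: A0.2 | exists (y, a)].
have c_le y a : G (y, a) -> c <= rnorm (y + y0) - a.
  by move=> g; apply: ge_sup; [exact: A0.1 | exact: (Aub (y, a))].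
split=> [r _ _ _ _ [r1 [y1 [a1 [g1 [-> ->]]]]] [r2 [y2 [a2 [g2 [-> ->]]]]]|].
  exists (r * r1 + r2), (r%:C%C *: y1 + y2), (r * a1 + a2); split; first exact: Glin.
  rewrite rmorphD rmorphM scalerDl -scalerA scalerDr; congr pair; last by ring.
  by rewrite !addrA; congr (_ + _); rewrite -!addrA; congr (_ + _); rewrite addrC.
move=> _ _ [r [y [a [g [-> ->]]]]].
have scaled s : 0 < s -> G ((s^-1)%:C%C *: y, s^-1 * a) by move=> s0; exact: Gscale.
have [r0|r0|->] := ltgtP r 0.
- have s0 : 0 < - r by rewrite oppr_gt0.
  have := c_ge _ _ (scaled _ s0).
  have -> : r%:C%C *: y0 + y = (- r)%:C%C *: (((- r)^-1)%:C%C *: y - y0).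
    rewrite scalerBr scalerA -rmorphM /= mulfV ?gt_eqF// scale1r rmorphN scaleNr.
    by rewrite opprK addrC.
  rewrite rnormZ_real gtr0_norm// lerBlDr -(ler_pM2l s0) mulrDr mulVKf ?gt_eqF//.
  by lra.
- have := c_le _ _ (scaled _ r0).
  have -> : r%:C%C *: y0 + y = r%:C%C *: ((r^-1)%:C%C *: y + y0).
    by rewrite scalerDr scalerA -rmorphM /= mulfV ?gt_eqF// scale1r addrC.
  rewrite rnormZ_real gtr0_norm// lerBrDr -(ler_pM2l r0) mulrDr mulVKf ?gt_eqF//.
- by rewrite mul0r add0r scale0r add0r Gdom.
Qed.

Lemma real_hahn_banach G0 : G0 (0, 0) -> dominated_graph G0 ->
  exists F : Y -> R, [/\ forall r x y, F (r%:C%C *: x + y) = r * F x + F y,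
    forall y, F y <= rnorm y & forall y a, G0 (y, a) -> F y = a].
Proof.
move=> G00 dG0.
(* Each [B] is joined to [G0] so that the empty chain, whose union is empty, satisfies the predicate
   too. *)
have [C CP C0|A [dA Amax]] := @Zorn_bigcup _ [set B | dominated_graph (G0 `|` B)].
  have two p q : (G0 `|` \bigcup_(X in C) X) p -> (G0 `|` \bigcup_(X in C) X) q ->
      exists B, [/\ dominated_graph B, B p, B q & B `<=` G0 `|` \bigcup_(X in C) X].
    move=> [gp|[X CX Xp]] [gq|[Z CZ Zq]].
    - by exists G0; split=> //; left.
    - exists (G0 `|` Z); split; [exact: CP | by left | by right |].
      by move=> u [|Zu]; [left | right; exists Z].
    - exists (G0 `|` X); split; [exact: CP | by right | by left |].
      by move=> u [|Xu]; [left | right; exists X].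
    - have [XZ|ZX] := C0 _ _ CX CZ.
        exists (G0 `|` Z); split; [exact: CP | by right; exact: XZ | by right |].
        by move=> u [|Zu]; [left | right; exists Z].
      exists (G0 `|` X); split; [exact: CP | by right | by right; exact: ZX |].
      by move=> u [|Xu]; [left | right; exists X].
  split=> [r y1 a1 y2 a2 g1 g2|y a g].
    by have [B [[Blin _] B1 B2 Bsub]] := two _ _ g1 g2; apply: Bsub; exact: Blin.
  by have [B [[_ Bdom] B1 _ _]] := two _ _ g g; exact: Bdom.
pose G := G0 `|` A.
have GG0 : G (0, 0) by left.
(* A point outside the domain would allow a one-dimensional extension, against maximality. *)
have tot y : exists a, G (y, a).
  apply: contrapT => nG.
  have [c dG'] := graph_extension y GG0 dA.
  set G' := (X in dominated_graph X) in dG'.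
  have GG' u a : G (u, a) -> G' (u, a).
    by move=> g; exists 0, u, a; split=> //; rewrite scale0r mul0r !add0r.
  have G'c : G' (y, c) by exists 1, 0, 0; split=> //; rewrite scale1r mul1r !addr0.
  apply: (Amax G').
    split; first by move=> [u a] Au; apply: GG'; right.
    by move=> /(_ _ G'c) Ac; apply: nG; exists c; right.
  rewrite /= (_ : G0 `|` G' = G')//.
  by apply/seteqP; split=> [[u a] [g|//]|u ?]; [apply: GG'; left | right].
have [Glin Gdom] := dA.
have uniq_val y a b : G (y, a) -> G (y, b) -> a = b.
  move=> ga gb; have le u v : G (y, u) -> G (y, v) -> u <= v.
    move=> gu gv; have gv' := Glin (-1) _ _ _ _ gv GG0.
    have := Glin 1 _ _ _ _ gu gv'.
    rewrite rmorph1 rmorphN1 scaleN1r scale1r !addr0 subrr => /Gdom.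
    by rewrite /rnorm normr0 /=; lra.
  by apply/eqP; rewrite eq_le !le.
pose F y := projT1 (cid (tot y)).
have FG y : G (y, F y) by exact: projT2 (cid (tot y)).
exists F; split.
- by move=> r x y; apply: (uniq_val (r%:C%C *: x + y) _ _ (FG _)); exact: Glin (FG x) (FG y).
- by move=> y; exact: Gdom (FG y).
- by move=> y a g; apply: (uniq_val y _ _ (FG y)); left.
Qed.

(** Extend the real part to a real functional [F] and recover the complex one as F(y) - i F(iy). *)
Lemma complex_hahn_banach (X : normedModType R[i]) (j : {linear X -> Y})
    (phi : {linear X -> R[i]^o}) :
  (forall u : X, `|j u| = `|u|) ->
  (forall u : X, rnorm (phi u : R[i]) <= rnorm u) ->
  exists Phi : {linear Y -> R[i]^o},
    (forall y, rnorm (Phi y : R[i]) <= rnorm y) /\ (forall u, Phi (j u) = phi u).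
Proof.
move=> jnorm phile.
have rj u : rnorm (j u) = rnorm u by rewrite /rnorm jnorm.
pose G0 : set (Y * R) := [set (j u, complex.Re (phi u : R[i])) | u in setT].
have G00 : G0 (0, 0) by exists 0 => //; rewrite !linear0.
have ReZ (r : R) (u : R[i]) : complex.Re (r%:C%C * u) = r * complex.Re u.
  by case: u => a b /=; rewrite mul0r subr0.
have dG0 : dominated_graph G0.
  split=> [r _ _ _ _ [x1 _ [<- <-]] [x2 _ [<- <-]]|_ _ [x _ [<- <-]]].
    by exists (r%:C%C *: x1 + x2) => //; rewrite !linearP raddfD /= ReZ.
  rewrite rj (le_trans _ (phile x))// (le_trans _ (Re_le_rnorm _))//.
  exact: ler_norm.
have [F [Flin Fle FG]] := real_hahn_banach G00 dG0.
have FD x y : F (x + y) = F x + F y.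
  by rewrite -[x in LHS]scale1r (Flin 1) mul1r.
have F0 : F 0 = 0 by have := FD 0 0; rewrite addr0; lra.
have FZ r x : F (r%:C%C *: x) = r * F x.
  by rewrite -[r%:C%C *: x]addr0 Flin F0 addr0.
pose I : R[i] := Complex 0 1.
pose Phi y : R[i]^o := Complex (F y) (- F (I *: y)).
have FI y : F (I *: (I *: y)) = - F y.
  rewrite scalerA (_ : I * I = (-1)%:C%C); last by rewrite -expr2 sqr_i rmorphN1.
  by rewrite FZ mulN1r.
have PhiD x y : Phi (x + y) = Phi x + Phi y.
  by rewrite /Phi scalerDr !FD opprD.
have PhiR r x : Phi (r%:C%C *: x) = r%:C%C * (Phi x : R[i]).
  rewrite /Phi scalerA mulrC -scalerA !FZ.
  by apply/eqP; rewrite eq_complex /= !mul0r subr0 addr0 mulrN !eqxx.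
have PhiI x : Phi (I *: x) = I * (Phi x : R[i]).
  rewrite /Phi FI; apply/eqP; rewrite eq_complex /=.
  by rewrite !mul0r !mul1r sub0r add0r !opprK !eqxx.
have PhiZ (c : R[i]) x : Phi (c *: x) = c * (Phi x : R[i]).
  by rewrite [c]complexE scalerDl PhiD -scalerA PhiI !PhiR mulrDl mulrA.
have Phi_linear : linear Phi by move=> c x y; rewrite PhiD PhiZ.
pose L : {linear Y -> R[i]^o} := HB.pack Phi
  (GRing.isLinear.Build _ _ _ _ Phi Phi_linear).
exists L; split=> [y|u].
  rewrite -[L y]/(Phi y).
  have [->|nz] := eqVneq (Phi y : R[i]) 0; first by rewrite rnorm_real normr0 rnorm_ge0.
  (* This unimodular factor makes [Phi (c *: y)] real and equal to the modulus of [Phi y], so the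
     bound on [F] passes to [Phi]. *)
  pose c : R[i] := conjc (Phi y) / (rnorm (Phi y : R[i]))%:C%C.
  have rPhi : rnorm (Phi y : R[i]) != 0.
    by apply: contra nz => /eqP e; rewrite -normr_eq0 -rnormE e.
  have c1 : `|c| = 1.
    rewrite normrM normfV normcJ -rnormE ger0_norm ?lecR ?rnorm_ge0//.
    by rewrite divff//; apply: contra rPhi => /eqP /(@complexI R) ->.
  have Phic : Phi (c *: y) = (rnorm (Phi y : R[i]))%:C%C.
    rewrite PhiZ /c mulrAC conjc_mul_self rmorphXn /= expr2 mulfK//.
    by apply: contra rPhi => /eqP /(@complexI R) ->.
  have : F (c *: y) = rnorm (Phi y : R[i]) by move: Phic; rewrite /Phi => -[].
  move=> <-; apply: le_trans (Fle _) _.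
  by rewrite le_rnorm normrZ c1 mul1r rnormE.
rewrite -[L _]/(Phi _) /Phi.
have -> : F (j u) = complex.Re (phi u : R[i]) by apply: FG; exists u.
rewrite -linearZ (FG _ (complex.Re (phi (I *: u) : R[i]))); last by exists (I *: u).
rewrite linearZ /= /GRing.scale /=.
by case: (phi u : R[i]) => a b /=; rewrite mul0r mul1r sub0r opprK.
Qed.
End HahnBanach.

(** * Upper bound *)

Section UpperBound.
Variables (R : realType) (n d N : nat) (zeta : R[i]).
Hypotheses (zetaP : N.-primitive_root zeta) (dN : (d < N)%N).
Local Notation W := {ffun 'I_n -> 'I_N}.
Local Notation xi := (@root_pt R n N zeta).
Local Notation X := (homog_poly R n d).

(** The complete homogeneous symmetric polynomial of degree [d]. *)
Definition hsum (v : 'I_n -> R[i]) : R[i] :=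
  \sum_(m : bmultinom n d.+1 | mdeg m == d) mono v m.

Lemma meval_of_coef c v : meval v (mpoly_of_dhomog (homog_poly_of_coef d c : X)) =
  \sum_(m : bmultinom n d.+1 | mdeg m == d) c m * mono v m.
Proof.
rewrite mpoly_of_coef raddf_sum; apply: eq_bigr => m _ /=.
by rewrite mevalZ meval_mono.
Qed.

Variable U : R.
Hypothesis avg_le_U : forall u : 'I_n -> R[i], (forall i, rnorm (u i) = 1) ->
  avg (fun w : W => rnorm (hsum (fun i => u i * xi w i))) <= U.

Lemma eval_linear (v : 'I_n -> R[i]) :
  linear (fun p : X => meval v (mpoly_of_dhomog p) : R[i]^o).
Proof.
move=> a p q.
rewrite (_ : mpoly_of_dhomog _ = a *: mpoly_of_dhomog p + mpoly_of_dhomog q)//.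
by rewrite mevalD mevalZ.
Qed.

Lemma exists_projection (Y : completeNormedModType R[i]) (j : {linear X -> Y}) :
  (forall p, `|j p| = `|p|) ->
  exists P : {linear Y -> Y}, [/\ continuous P, (forall y, P (P y) = P y),
    range P = range j & forall y, rnorm (P y) <= U * rnorm y].
Proof.
move=> jnorm.
have /boolp.choice[Phi PhiP] : forall w : W, exists Phi : {linear Y -> R[i]^o},
    (forall y, rnorm (Phi y : R[i]) <= rnorm y) /\
    (forall p, Phi (j p) = meval (xi w) (mpoly_of_dhomog p)).
  move=> w.
  pose phi0 (p : X) : R[i]^o := meval (xi w) (mpoly_of_dhomog p).
  pose phi : {linear X -> R[i]^o} := HB.pack phi0
    (GRing.isLinear.Build _ _ _ _ phi0 (eval_linear (xi w))).
  have [|Phi [Phi1 Phi2]] := complex_hahn_banach (phi := phi) jnorm.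
    by move=> p; apply: homog_poly_norm_eval => i; rewrite (root_pt_rnorm zetaP).
  by exists Phi.
(* Fourier coefficients, with the extended evaluations [Phi w] in place of the values at the sample
   points. *)
pose c y (m : multinom n) : R[i] :=
  avg (fun w : W => (Phi w y : R[i]) * conjc (mono (xi w) m)).
pose Q y : X := homog_poly_of_coef d (c y).
have cP (a : R[i]) x y m : c (a *: x + y) m = a * c x m + c y m.
  rewrite /c -avgZ -avgD; apply: eq_avg => w.
  by rewrite linearP mulrDl -mulrA.
have Q_linear : linear Q.
  move=> a x y; rewrite /Q /homog_poly_of_coef scaler_sumr -big_split.
  by apply: eq_bigr => m _ /=; rewrite cP scalerDl scalerA.
have Qj p : Q (j p) = p.
  apply: val_inj; apply/mpolyP => m; rewrite /= mcoeff_of_coef.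
  case: eqP => [md|/eqP md]; last by rewrite mcoeff_homog0.
  rewrite -(mcoeff_avg zetaP) ?md//.
    by apply: eq_avg => w; rewrite (PhiP w).2.
  exact: leq_trans (msize_homog (dhomog_is_dhomog p)) _.
have Qnorm y : rnorm (Q y) <= U * rnorm y.
  apply: homog_poly_norm_le_torus => u u1; rewrite meval_of_coef.
  (* Summing over [m] first produces [hsum] as reproducing kernel. Conjugating its argument brings
     the mean of its modulus into the form of [avg_le_U]. *)
  have -> : \sum_(m : bmultinom n d.+1 | mdeg m == d) c y m * mono u m =
     avg (fun w : W => Phi w y * hsum (fun i => u i * conjc (xi w i))).
    under eq_bigr do rewrite mulrC -avgZ.
    rewrite -avg_sum; apply: eq_avg => w; rewrite /hsum mulr_sumr.
    by apply: eq_bigr => m _; rewrite monoM mono_conj; ring.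
  apply: le_trans (rnorm_avg_le _) _.
  have cu1 i : rnorm (conjc (u i)) = 1 by rewrite rnorm_conj.
  rewrite mulrC; apply: le_trans (ler_wpM2l (rnorm_ge0 y) (avg_le_U cu1)).
  rewrite -avgZ; apply: avg_le => w; rewrite rnormM ler_pM ?rnorm_ge0 ?(PhiP w).1//.
  rewrite -rnorm_conj /hsum rmorph_sum /= le_eqVlt; apply/orP; left; apply/eqP.
  congr rnorm; apply: eq_bigr => m _; rewrite -mono_conj; apply: eq_bigr => i _.
  by rewrite /= rmorphM /= conjcK.
have P_linear : linear (j \o Q : Y -> Y).
  by move=> a x y; rewrite /= Q_linear linearP.
pose P : {linear Y -> Y} := HB.pack (j \o Q : Y -> Y)
  (GRing.isLinear.Build _ _ _ _ (j \o Q : Y -> Y) P_linear).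
have PE y : P y = j (Q y) by [].
have Pnorm y : rnorm (P y) <= U * rnorm y.
  by rewrite PE (_ : rnorm (j _) = rnorm (Q y)) ?Qnorm// /rnorm jnorm.
exists P; split=> //.
- move=> y0; apply/cvgrPdist_le => /= e e0.
  have [eR eE] : {r : R | e = r%:C%C}.
    by exists (complex.Re e); rewrite RRe_real// gtr0_real.
  have eR0 : 0 < eR by rewrite eE ltcR in e0.
  have k0 : 0 < (eR / (`|U| + 1))%:C%C by rewrite ltcR divr_gt0// ltr_pwDr.
  near=> y; rewrite -[_ - _](linearB P) eE -le_rnorm; apply: le_trans (Pnorm _) _.
  have : rnorm (y0 - y) <= eR / (`|U| + 1).
    by rewrite le_rnorm; near: y; apply: cvgr_dist_le => //; exact: cvg_id.
  have U1 : 0 < `|U| + 1 by rewrite ltr_pwDr.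
  rewrite ler_pdivlMr// => H; apply: le_trans H; rewrite mulrC ler_wpM2l ?rnorm_ge0//.
  by rewrite (le_trans (ler_norm _))// lerDl.
- by move=> y; rewrite !PE Qj.
- apply/seteqP; split=> [_ [y _ <-]|_ [p _ <-]]; first by exists (Q y).
  by exists (j p) => //; rewrite PE Qj.
Unshelve. all: by end_near.
Qed.

Lemma projection_constant_le : (projection_constant X <= U%:E)%E.
Proof.
apply: ge_ereal_sup => _ [Y [j [jnorm ->]]].
have [P [Pc PP Pr Pn]] := exists_projection jnorm.
have U0 : 0 <= U.
  by apply: le_trans (avg_le_U (u := fun=> 1) _); [apply: avg_ge0 => w; exact: rnorm_ge0
    | move=> i; rewrite rnorm_real normr1].
apply: (@le_trans _ _ (operator_norm P)).
  by apply: ereal_inf_lbound; exists P.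
apply: ge_ereal_sup => _ [y /= y1 <-]; rewrite lee_fin (le_trans (Pn y))//.
by rewrite ler_piMr// le_rnorm.
Qed.
End UpperBound.

(** * Lower bound *)

Section SquareRootIteration.
Variable R : realFieldType.

(* With u = s^2, [u * rsqrt_iter k u] is the classical polynomial iteration
   p' = p + (u - p^2) / 2 increasing to sqrt u. *)
Fixpoint rsqrt_iter (k : nat) (u : R) : R :=
  if k is k'.+1 then
    rsqrt_iter k' u + (1 - u * rsqrt_iter k' u ^+ 2) / 2
  else 0.

(** The error [e j] is multiplied by [1 - (s + s ^+ 2 * q j) / 2] at each step. By induction it is
    at most s / (1 + j s / 2), hence at most 2 / j for positive j. *)
Lemma rsqrt_iterP k (s : R) : 0 <= s <= 1 ->
  [/\ 0 <= rsqrt_iter k (s ^+ 2), s * rsqrt_iter k (s ^+ 2) <= 1 &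
    k%:R * (s - s ^+ 2 * rsqrt_iter k (s ^+ 2)) <= 2].
Proof.
move=> /andP[s0 s1]; set q := fun k => rsqrt_iter k (s ^+ 2).
have qP j : 0 <= q j /\ s * q j <= 1.
  elim: j => [|j [q0 q1]]; first by rewrite /q /= mulr0 lexx ler01.
  rewrite /q /= -/(q j); set a := q j in q0 q1 *.
  have sa : 0 <= s * a by exact: mulr_ge0.
  have sa2 : (s * a) ^+ 2 <= 1 by rewrite expr_le1.
  split; first by move: sa2; rewrite exprMn; lra.
  rewrite (_ : _ * _ = s * a + s * (1 - (s * a) ^+ 2) / 2); last by field.
  have : s * (1 - (s * a) ^+ 2) <= 1 - (s * a) ^+ 2 by rewrite ler_piMl// subr_ge0.
  have := sqr_ge0 (1 - s * a); lra.
have [q0 q1] := qP k; split=> //.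
pose e j := s - s ^+ 2 * q j.
have eE j : e j = s * (1 - s * q j) by rewrite /e; ring.
have e0 j : 0 <= e j.
  by have [? ?] := qP j; rewrite eE mulr_ge0// subr_ge0.
have eP j : e j * (1 + j%:R * (s / 2)) <= s.
  elim: j => [|j IH]; first by rewrite /e /q /=; lra.
  have [a0 a1] := qP j; have ej := e0 j.
  have -> : e j.+1 = e j * (1 - (s + s ^+ 2 * q j) / 2).
    by rewrite /e /q /= -/(q j); field.
  apply: le_trans IH; rewrite -mulrA ler_wpM2l// -natr1.
  have j0 : 0 <= j%:R :> R by exact: ler0n.
  have p0 : 0 <= s ^+ 2 * q j by rewrite mulr_ge0 ?sqr_ge0.
  set A := 1 + j%:R * (s / 2).
  have A1 : 1 <= A by rewrite lerDl mulr_ge0// divr_ge0.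
  rewrite (_ : 1 + _ * _ = A + s / 2); last by rewrite /A; ring.
  have k1 : 0 <= s * (A - 1) by rewrite mulr_ge0// subr_ge0.
  have k2 : 0 <= (s ^+ 2 * q j) * (A + s / 2) by apply: mulr_ge0 => //; lra.
  have key (x p : R) : 0 <= s * (x - 1) -> 0 <= p * (x + s / 2) ->
      (1 - (s + p) / 2) * (x + s / 2) <= x by have := sqr_ge0 s; lra.
  exact: key.
rewrite -/(q k) -/(e k).
have [s00|sn0] := eqVneq s 0.
  by rewrite /e s00 expr0n mul0r subrr mulr0.
have sgt0 : 0 < s by rewrite lt_neqAle eq_sym sn0.
have := eP k; rewrite mulrDr mulr1 => H.
have : s * (k%:R * e k) <= s * 2 by have := e0 k; lra.
by rewrite ler_pM2l.
Qed.
End SquareRootIteration.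

Section MonomialShift.
Variables (R : realType) (n : nat).
Implicit Types (p : mpoly n R[i]) (m : multinom n) (v : 'I_n -> R[i]).

Definition cst_mnm (M : nat) : multinom n := Multinom (nseq_tuple n M).

Lemma cst_mnmE M i : cst_mnm M i = M.
Proof. by rewrite multinomE tnth_nseq. Qed.

Lemma mdeg_cst_mnm M : mdeg (cst_mnm M) = (n * M)%N.
Proof.
rewrite mdegE (eq_bigr (fun=> M)) ?sum_nat_const ?card_ord// => i _.
exact: cst_mnmE.
Qed.

Lemma mcoeff_mulX p m m' : mcoeff m' (p * mpolyX R[i] m) =
  if lem m m' then mcoeff (mnm_sub m' m) p else 0.
Proof.
case: ifP => [mm'|nmm'].
  by rewrite -[in LHS](submK mm') addmC mcoeffMX.
apply: memN_msupp_eq0; rewrite (perm_mem (msuppMX _ _)).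
apply/negP => /mapP[k _ e]; move/negP: nmm'; apply; rewrite e; exact: lem_addr.
Qed.

Lemma indhomog_val d p : p \is is_homog d -> mpoly_of_dhomog (indhomog d p) = p.
Proof. by move=> pd; rewrite /indhomog val_insubd pd. Qed.
End MonomialShift.
Arguments cst_mnm n M : clear implicits.

(** * Embedding by a monomial factor and averaging of projections *)

Section Embedding.
Variables (R : realType) (n d M : nat).
Local Notation D := (d + n * M)%N.
Local Notation X := (homog_poly R n d).
Local Notation Y := (homog_poly R n D).
Local Notation shiftX := (mpolyX R[i] (cst_mnm n M)).

Lemma mul_shift_homog (p : X) : mpoly_of_dhomog p * shiftX \is is_homog D.
Proof.
apply: dhomogM; first exact: dhomog_is_dhomog.
by rewrite dhomogX; apply/eqP; exact: mdeg_cst_mnm.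
Qed.

Definition embed0 (p : X) : Y := indhomog D (mpoly_of_dhomog p * shiftX).

Lemma embed0E p : mpoly_of_dhomog (embed0 p) = mpoly_of_dhomog p * shiftX.
Proof. exact: indhomog_val (mul_shift_homog p). Qed.

Lemma embed0_linear : linear embed0.
Proof.
move=> c p q; apply: val_inj; rewrite /= embed0E.
transitivity (c *: mpoly_of_dhomog (embed0 p) + mpoly_of_dhomog (embed0 q)) => //.
by rewrite !embed0E scalerAl -mulrDl.
Qed.

Definition embed : {linear X -> Y} := HB.pack embed0
  (GRing.isLinear.Build _ _ _ _ embed0 embed0_linear).

Lemma meval_embed v p : meval v (mpoly_of_dhomog (embed p)) =
  meval v (mpoly_of_dhomog p) * mono v (cst_mnm n M).
Proof. by rewrite embed0E mevalM meval_mono. Qed.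

(** The norm is determined on the torus, where the monomial factor has modulus one. *)
Lemma embed_norm p : `|embed p| = `|p|.
Proof.
have normE u : (forall i, rnorm (u i) = 1) ->
    rnorm (meval u (mpoly_of_dhomog (embed p))) = rnorm (meval u (mpoly_of_dhomog p)).
  by move=> u1; rewrite meval_embed rnormM mono_rnorm1 ?mulr1.
rewrite -!rnormE; congr _%:C%C; apply/eqP; rewrite eq_le; apply/andP; split;
  apply: homog_poly_norm_le_torus => u u1.
  by rewrite normE// homog_poly_norm_eval// => i; rewrite u1.
by rewrite -normE// homog_poly_norm_eval// => i; rewrite u1.
Qed.

Lemma mcoeff_embed p m : mcoeff m (mpoly_of_dhomog (embed p)) =
  if lem (cst_mnm n M) m then mcoeff (mnm_sub m (cst_mnm n M)) (mpoly_of_dhomog p) else 0.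
Proof. by rewrite embed0E mcoeff_mulX. Qed.

Section Averaging.
Variables (N : nat) (zeta : R[i]).
Hypotheses (zetaP : N.-primitive_root zeta) (DN : (D < N)%N).
Local Notation W := {ffun 'I_n -> 'I_N}.
Local Notation xi := (@root_pt R n N zeta).

(** The value at (1, ..., 1) of the Fourier projection of [f] onto the range of [embed]. *)
Definition shifted_coef_sum (f : Y) : R[i] :=
  \sum_(m : bmultinom n D.+1 | (mdeg m == D) && lem (cst_mnm n M) m)
     mcoeff m (mpoly_of_dhomog f).

Definition rotate (f : Y) (w : W) : Y :=
  homog_poly_of_coef D (fun m => conjc (mono (xi w) m) * mcoeff m (mpoly_of_dhomog f)).

Lemma homog_poly_coefE (f : Y) : 
  homog_poly_of_coef D (fun m => mcoeff m (mpoly_of_dhomog f)) = f.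
Proof.
apply: val_inj; apply/mpolyP => m; rewrite /= mcoeff_of_coef.
by case: eqP => // /eqP md; rewrite mcoeff_homog0.
Qed.

Lemma meval_rotate f w v : meval v (mpoly_of_dhomog (rotate f w)) =
  meval (fun i => v i * conjc (xi w i)) (mpoly_of_dhomog f).
Proof.
rewrite -[f in RHS]homog_poly_coefE !meval_of_coef; apply: eq_bigr => m _.
by rewrite monoM mono_conj; ring.
Qed.

Lemma rotate_norm f w : rnorm (rotate f w) <= rnorm f.
Proof.
apply: homog_poly_norm_le_torus => u u1; rewrite meval_rotate.
apply: homog_poly_norm_eval => i.
by rewrite rnormM u1 rnorm_conj (root_pt_rnorm zetaP) mulr1.
Qed.

(* Rudin's averaging: conjugating [P] by the rotations of the finite group and
   averaging leaves the projection that keeps the coefficients of [embed]'s range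
   and kills all others. *)
Lemma avg_rotate_projection (P : {linear Y -> Y}) (f : Y) :
  (forall y, P (P y) = P y) -> range P = range embed ->
  avg (fun w : W => meval (xi w) (mpoly_of_dhomog (P (rotate f w)))) =
  shifted_coef_sum f.
Proof.
move=> PP rP; pose e m : Y := indhomog D (mpolyX R[i] m).
have PE w : meval (xi w) (mpoly_of_dhomog (P (rotate f w))) =
    \sum_(m : bmultinom n D.+1 | mdeg m == D) mcoeff m (mpoly_of_dhomog f) *
      (meval (xi w) (mpoly_of_dhomog (P (e m))) * conjc (mono (xi w) m)).
  rewrite /rotate /homog_poly_of_coef linear_sum raddf_sum raddf_sum.
  apply: eq_bigr => m _ /=; rewrite linearZ.
  transitivity (meval (xi w) ((conjc (mono (xi w) m) * mcoeff m (mpoly_of_dhomog f)) *: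
     mpoly_of_dhomog (P (e m)))) => //.
  by rewrite mevalZ; ring.
rewrite (eq_avg PE) avg_sum /shifted_coef_sum.
rewrite [in RHS]big_mkcondr; apply: eq_bigr => m md.
(* The mean extracts the coefficient of [P (e m)] at [m], the diagonal of [P]. It is 0 when [m] does
   not occur in the range of [embed], and 1 when [e m] lies in that range and is fixed by [P]. *)
rewrite avgZ (mcoeff_avg zetaP); last 2 first.
- exact: leq_trans (msize_homog (dhomog_is_dhomog _)) _.
- by rewrite (eqP md).
have [q _ qE] : range embed (P (e m)) by rewrite -rP; exists (e m).
case: ifP => [Mm|nMm]; last by rewrite -qE mcoeff_embed nMm mulr0.
have em : embed (indhomog d (mpolyX R[i] (mnm_sub m (cst_mnm n M)))) = e m.
  have mdD : mdeg (mnm_sub m (cst_mnm n M)) == d.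
    have := submK Mm => /(congr1 mdeg); rewrite mdegD mdeg_cst_mnm (eqP md) => H.
    by apply/eqP; lia.
  apply: val_inj; rewrite /= embed0E !indhomog_val ?dhomogX//.
  by rewrite -mpolyXD submK.
have Pe : P (e m) = e m.
  have : range P (e m).
    by rewrite rP; exists (indhomog d (mpolyX R[i] (mnm_sub m (cst_mnm n M)))).
  by case=> y _ <-; rewrite PP.
by rewrite Pe indhomog_val ?dhomogX// mcoeffX eqxx mulr1.
Qed.

Lemma projection_constant_ge_coef (f : Y) : rnorm f <= 1 ->
  ((rnorm (shifted_coef_sum f))%:E <= projection_constant X)%E.
Proof.
move=> f1; apply: (@le_trans _ _ (relative_projection_constant (range embed))); last first.
  by apply: ereal_sup_ubound; exists Y, embed; split=> //; exact: embed_norm.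
apply: le_ereal_inf_tmp => _ [P [_ PP rP] <-].
have opP w : ((rnorm (P (rotate f w)))%:E <= operator_norm P)%E.
  apply: ereal_sup_ubound; exists (rotate f w) => //=.
  by rewrite -rnormE -[1]/(1%:C%C) lecR (le_trans (rotate_norm f w)).
have W0 := card_root_gt0 n zetaP.
case E : (operator_norm P) => [C| |].
- rewrite lee_fin -(avg_rotate_projection f PP rP) (le_trans (rnorm_avg_le _))//.
  rewrite -[leRHS](avg_cst C W0); apply: avg_le => w.
  have := opP w; rewrite E lee_fin; apply: le_trans.
  by apply: homog_poly_norm_eval => i; rewrite (root_pt_rnorm zetaP).
- exact: leey.
- by have /card_gt0P[w _] := W0; have := opP w; rewrite E leeNy_eq.
Qed.
End Averaging.
End Embedding.

(** * A nearly extremal polynomial for the Fourier projection *)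

Section LowerBound.
Variables (R : realType) (n d : nat).
Hypothesis n_gt0 : (0 < n)%N.
Local Notation X := (homog_poly R n d).
Local Notation h := (@hsum R n d).

Definition hpoly : X := homog_poly_of_coef d (fun=> 1).

Lemma meval_hpoly v : meval v (mpoly_of_dhomog hpoly) = h v.
Proof. by rewrite meval_of_coef; apply: eq_bigr => m _; rewrite mul1r. Qed.

Definition hpoly_conj : mpoly n R[i] :=
  \sum_(m : bmultinom n d.+1 | mdeg m == d) mpolyX R[i] (mnm_sub (cst_mnm n d) m).

Lemma lem_cst_mnm (m : multinom n) : mdeg m = d -> lem m (cst_mnm n d).
Proof.
move=> md; apply/mnm_lepP => i; rewrite cst_mnmE -md mdegE (bigD1 i)//=.
exact: leq_addr.
Qed.

Lemma hpoly_conj_homog : hpoly_conj \is is_homog (n * d - d)%N.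
Proof.
apply: rpred_sum => m /eqP md; rewrite dhomogX /=; apply/eqP.
have := submK (lem_cst_mnm md) => /(congr1 mdeg).
by rewrite mdegD mdeg_cst_mnm md => <-; rewrite addnK.
Qed.

Lemma conjc_unit (u : R[i]) : rnorm u = 1 -> u * conjc u = 1.
Proof. by move=> u1; rewrite mulrC conjc_mul_self u1 expr1n. Qed.

Lemma meval_hpoly_conj v : (forall i, rnorm (v i) = 1) ->
  meval v hpoly_conj = mono v (cst_mnm n d) * conjc (h v).
Proof.
move=> v1; rewrite raddf_sum rmorph_sum mulr_sumr; apply: eq_bigr => m /eqP md /=.
rewrite meval_mono -[in RHS](submK (lem_cst_mnm md)).
have monoD (a b : multinom n) : mono v (mnm_add a b) = mono v a * mono v b.
  by rewrite /mono -big_split; apply: eq_bigr => i _; rewrite mnmDE exprD.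
by rewrite monoD -mulrA conjc_unit ?mulr1// mono_rnorm1.
Qed.

(* On the torus [conjc (h v)] is [meval v hpoly_conj] divided by a monomial, so
   that multiplying by a high enough power of [z_1 ... z_n] turns the polynomial
   [rsqrt_iter k] in [|h|^2 / B^2] into a homogeneous one. *)
Lemma homogenized_iter (B : R) k : exists M, exists2 Q : mpoly n R[i],
  Q \is is_homog (n * M)%N &
  forall v, (forall i, rnorm (v i) = 1) ->
    meval v Q = mono v (cst_mnm n M) * (rsqrt_iter k ((rnorm (h v) / B) ^+ 2))%:C%C.
Proof.
elim: k => [|k [M [Q Qh QE]]].
  by exists 0%N, 0; [exact: rpred0 | move=> v v1; rewrite meval0 /= mulr0].
pose c : R[i] := (2^-1)%:C%C; pose b : R[i] := (B^-1)%:C%C.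
(* The three terms of the iteration carry the powers M, 0 and M + M + d of z_1 ... z_n; the first
   two are raised to the third. *)
exists (M + M + d)%N, (mpolyX R[i] (cst_mnm n (M + d)) * Q +
   c *: (mpolyX R[i] (cst_mnm n (M + M + d))
     - (b ^+ 2) *: (mpoly_of_dhomog hpoly * hpoly_conj * (Q * Q)))).
  (* This makes the truncated subtraction in the degree of [hpoly_conj] exact. *)
  have dn : (d <= n * d)%N by rewrite leq_pmull.
  apply: rpredD.
    rewrite (_ : n * (M + M + d) = n * (M + d) + n * M)%N; last by lia.
    by apply: dhomogM => //; rewrite dhomogX /= mdeg_cst_mnm.
  apply: rpredZ; apply: rpredB; first by rewrite dhomogX /= mdeg_cst_mnm.
  apply: rpredZ.
  rewrite (_ : n * (M + M + d) = d + (n * d - d) + (n * M + n * M))%N; last by lia.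
  apply: dhomogM; apply: dhomogM => //; first exact: dhomog_is_dhomog.
  exact: hpoly_conj_homog.
move=> v v1; have hv := conjc_mul_self (h v).
have monoD a a' : mono v (cst_mnm n (a + a')) = mono v (cst_mnm n a) * mono v (cst_mnm n a').
  rewrite /mono -big_split; apply: eq_bigr => i _ /=.
  by rewrite !cst_mnmE exprD.
rewrite !(mevalD, mevalN, mevalB, mevalZ, mevalM) !meval_mono QE//.
rewrite meval_hpoly meval_hpoly_conj// !monoD.
set m := mono v _; set md := mono v _; set q := rsqrt_iter _ _ => /=.
rewrite -/q.
have -> : (q + (1 - (rnorm (h v) / B) ^+ 2 * q ^+ 2) / 2)%:C%C =
  q%:C%C + c * (1 - (conjc (h v) * h v) * b ^+ 2 * q%:C%C ^+ 2).
  rewrite hv /c /b -!rmorphXn -!rmorphM -(rmorph1 (real_complex R)) -rmorphB -rmorphM -rmorphD /=.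
  by congr (_%:C%C); rewrite exprMn exprVn; ring.
rewrite /=; ring.
Qed.

Lemma sum_mono_shift M v :
  \sum_(m : bmultinom n (d + n * M).+1 | (mdeg m == (d + n * M)%N) && lem (cst_mnm n M) m)
    mono v m = h v * mono v (cst_mnm n M).
Proof.
rewrite -meval_hpoly -meval_embed (meval_coef _ (msize_homog (dhomog_is_dhomog _))).
rewrite big_mkcond; apply: eq_bigr => m _.
rewrite mcoeff_embed mcoeff_of_coef; case: (boolP (lem _ _)) => Mm; last by rewrite andbF mul0r.
have := submK Mm => /(congr1 mdeg); rewrite mdegD mdeg_cst_mnm => <-.
by rewrite andbT eqn_add2r; case: eqP; rewrite ?mul1r ?mul0r.
Qed.

(** On the torus [f] has modulus [rnorm (h v) / B * q v], at most 1. Its shifted coefficient sum is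
    the mean of [rnorm (h v) ^+ 2 / B * q v], which [rsqrt_iterP] puts within [2 * B / k.+1] of the
    mean of [rnorm (h v)]. *)
Lemma exists_sampled_lower_bound (eps : R) : 0 < eps ->
  exists N, exists2 zeta : R[i], N.-primitive_root zeta /\ (d + 2 < N)%N &
  ((avg (fun w : {ffun 'I_n -> 'I_N} => rnorm (h (root_pt zeta w))) - eps)%:E
     <= projection_constant X)%E.
Proof.
move=> eps0.
pose B : R := (#|{: bmultinom n d.+1}|.+1)%:R.
have B0 : 0 < B by rewrite ltr0n.
have hB v : (forall i, rnorm (v i) = 1) -> rnorm (h v) <= B.
  move=> v1; rewrite (le_trans (rnorm_sum_le _ _))//.
  rewrite (eq_bigr (fun=> 1)); last by move=> m _; rewrite mono_rnorm1.
  by rewrite sumr_const ler_nat ltnW// ltnS max_card.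
pose k := Num.truncn (2 * B / eps).
have k_gt : 2 * B <= eps * k.+1%:R.
  by rewrite [leRHS]mulrC -ler_pdivrMr// ltW// truncnS_gt.
have [M [Q Qh QE]] := homogenized_iter B k.+1.
(* Larger than the degree of [f], as Fourier inversion requires, and than [d + 2]. *)
pose N := (d + n * M).+3.
have [zeta zetaP] := @prim_root_exists R N isT.
exists N, zeta; first by split=> //; rewrite /N; lia.
pose b : R[i] := (B^-1)%:C%C.
have fh : b *: (mpoly_of_dhomog hpoly * Q) \is is_homog (d + n * M)%N.
  by apply: rpredZ; apply: dhomogM => //; exact: dhomog_is_dhomog.
pose f : homog_poly R n (d + n * M)%N := indhomog _ (b *: (mpoly_of_dhomog hpoly * Q)).
pose q v := rsqrt_iter k.+1 ((rnorm (h v) / B) ^+ 2).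
have fE v : (forall i, rnorm (v i) = 1) -> meval v (mpoly_of_dhomog f) =
    b * (h v * (mono v (cst_mnm n M) * (q v)%:C%C)).
  by move=> v1; rewrite indhomog_val// mevalZ mevalM meval_hpoly QE.
have s01 v : (forall i, rnorm (v i) = 1) -> 0 <= rnorm (h v) / B <= 1.
  by move=> v1; rewrite divr_ge0 ?rnorm_ge0 ?(ltW B0)// ler_pdivrMr// mul1r hB.
have f1 : rnorm f <= 1.
  apply: homog_poly_norm_le_torus => u u1.
  have [q0 q1 _] := rsqrt_iterP k.+1 (s01 u u1).
  rewrite fE// !rnormM !rnorm_real mono_rnorm1// mul1r.
  rewrite ger0_norm ?invr_ge0 ?(ltW B0)// (ger0_norm q0).
  by rewrite mulrA [_^-1 * _]mulrC.
have DN : (d + n * M < N)%N by rewrite /N; lia.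
apply: le_trans (projection_constant_ge_coef zetaP DN f1).
have xi1 (w : {ffun 'I_n -> 'I_N}) i : rnorm (root_pt zeta w i) = 1 by exact: root_pt_rnorm.
have sumE : shifted_coef_sum f = (avg (fun w : {ffun 'I_n -> 'I_N} =>
    B * ((rnorm (h (root_pt zeta w)) / B) ^+ 2 * q (root_pt zeta w))))%:C%C.
  rewrite /shifted_coef_sum.
  under eq_bigr => m /andP[/eqP md _].
    rewrite -(mcoeff_avg zetaP) ?md//; last first.
      exact: leq_trans (msize_homog (dhomog_is_dhomog f)) _.
    over.
  rewrite -avg_sum.
  transitivity (avg (fun w : {ffun 'I_n -> 'I_N} =>
      (B * ((rnorm (h (root_pt zeta w)) / B) ^+ 2 * q (root_pt zeta w)))%:C%C)); last first.
    by rewrite avg_real_complex.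
  apply: eq_avg => w; set v := root_pt zeta w.
  rewrite -mulr_sumr -rmorph_sum /= sum_mono_shift fE; last exact: xi1.
  have -> : conjc (h v * mono v (cst_mnm n M)) = conjc (h v) * conjc (mono v (cst_mnm n M)).
    exact: rmorphM.
  transitivity (b * (q v)%:C%C * (mono v (cst_mnm n M) * conjc (mono v (cst_mnm n M)))
     * (conjc (h v) * h v)); first by ring.
  rewrite (conjc_unit (mono_rnorm1 _ (xi1 w))) mulr1 conjc_mul_self /b -!rmorphM /=.
  by congr (_%:C%C); field; rewrite gt_eqF.
rewrite sumE lee_fin rnorm_real (le_trans _ (ler_norm _))//.
rewrite lerBlDr -[eps](avg_cst _ (card_root_gt0 n zetaP)) -avgD; apply: avg_le => w.
have [q0 q1] := rsqrt_iterP k.+1 (s01 _ (xi1 w)).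
rewrite -/(q _); set x := rnorm _; set y := q _ => H.
have k0 : 0 < k.+1%:R :> R by rewrite ltr0n.
have : k.+1%:R * (x - B * ((x / B) ^+ 2 * y)) <= k.+1%:R * eps.
  rewrite (_ : x - _ = B * (x / B - (x / B) ^+ 2 * y)); last by field; rewrite gt_eqF.
  rewrite mulrCA (le_trans (ler_wpM2l (ltW B0) H))// [leLHS]mulrC.
  by rewrite [leRHS]mulrC.
by rewrite ler_pM2l// lerBlDl addrC.
Qed.
End LowerBound.

(** * Asymptotics *)

Section RatioBounds.
Variable R : realFieldType.
Implicit Types g x y eps : R.

Lemma le_of_ratio_dist g x y eps : `|x / y - g| <= eps / 2 -> 0 < y ->
  (g - eps) * y <= x - eps / 2 * y.
Proof.
move=> + y0; rewrite ler_norml => /andP[H1 _].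
have : (g - eps / 2) * y <= x by rewrite -ler_pdivlMr//; lra.
lra.
Qed.

Lemma dist_le_of_bounds g x eps : 0 < eps -> x <= g + eps / 2 -> g - eps <= x ->
  `|x - g| <= eps.
Proof. by move=> eps0 up lo; rewrite ler_norml; apply/andP; split; lra. Qed.
End RatioBounds.

Section CountMonomials.

Lemma card_mnm_homog n d :
  #|[pred m : bmultinom n.+1 d.+1 | mdeg m == d]| = 'C(n + d, d).
Proof.
rewrite addnC -(size_basis n d) cardE -(size_map val).
apply/perm_size/uniq_perm => //.
  rewrite map_inj_uniq ?enum_uniq//; exact: val_inj.
  exact: uniq_basis.
move=> m; rewrite -basis_cover; apply/mapP/idP => [[k]|md].
  by rewrite mem_enum inE => kd ->.
have mS : (mdeg m < d.+1)%N by rewrite (eqP md).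
by exists (BMultinom mS); rewrite ?mem_enum ?inE.
Qed.

(** Passing from [d] to [d.+1] multiplies the ratio by 1 + d/n. *)
Lemma binomial_ratio_cvg (R : realType) d :
  (fun n => d`!%:R * 'C(n + d - 1, d)%:R / n%:R ^+ d : R) @ \oo --> (1 : R).
Proof.
elim: d => [|d IH].
  under eq_fun do rewrite bin0 expr0 divr1 mulr1.
  exact: cvg_cst.
have H : (fun n => (1 + d%:R * n%:R^-1) *
    (d`!%:R * 'C(n + d - 1, d)%:R / n%:R ^+ d) : R) @ \oo --> ((1 + d%:R * 0) * 1 : R).
  apply: cvgM IH; apply: cvgD; first exact: cvg_cst.
  apply: cvgM; first exact: cvg_cst.
  by rewrite -(cvg_shiftS (fun n => n%:R^-1 : R)); exact: cvg_harmonic.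
rewrite mulr0 addr0 mulr1 in H.
apply: cvg_trans H; apply: near_eq_cvg; near=> n.
have n0 : n%:R != 0 :> R by rewrite pnatr_eq0 -lt0n; near: n; exists 1%N.
have -> : (n + d.+1 - 1 = n + d)%N by lia.
have := mul_bin_diag (n + d) d; rewrite -subn1 => /(congr1 (fun k => k%:R : R)).
rewrite factS !natrM natrD exprS => E.
transitivity ((d`!%:R * ((n%:R + d%:R) * 'C(n + d - 1, d)%:R)) / (n%:R * n%:R ^+ d) : R).
  by field; rewrite n0 expf_neq0.
by rewrite E; congr (_ / _); ring.
Unshelve. all: by end_near.
Qed.
End CountMonomials.

(** * Mean-square comparison of S^d with d! h *)

Section PowerSumComparison.
Variables (R : realType) (n d N : nat) (zeta : R[i]).
Hypotheses (zetaP : N.-primitive_root zeta) (dN : (d < N)%N).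
Variable z : 'I_n -> R[i].
Hypothesis z1 : forall i, rnorm (z i) = 1.
Local Notation W := {ffun 'I_n -> 'I_N}.
Let pt (w : W) (i : 'I_n) : R[i] := z i * root_pt zeta w i.
Let S (w : W) : R[i] := \sum_i z i * root_pt zeta w i.
Let h (w : W) : R[i] := hsum d (pt w).

(** By orthogonality each monomial of [p] meets only its own copy in [hsum], where the rotation [z]
    cancels. All coefficients of [hsum] being one, the coefficients of [p] are summed. *)
Lemma avg_meval_conj_hsum (p : mpoly n R[i]) : p \is is_homog d ->
  avg (fun w : W => meval (pt w) p * conjc (h w)) = meval (fun=> 1) p.
Proof.
move=> pd; rewrite (meval_coef _ (msize_homog pd)).
transitivity (avg (fun w : W => \sum_(m : bmultinom n d.+1 | mdeg m == d)
    mcoeff m p)); last first.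
  rewrite (avg_cst _ (card_root_gt0 n zetaP)) big_mkcond; apply: eq_bigr => m _.
  have -> : mono (fun=> 1) m = 1 :> R[i].
    by rewrite /mono big1// => i _; rewrite expr1n.
  rewrite mulr1; case: eqP => // /eqP md.
  by rewrite (dhomog_nemf_coeff pd).
rewrite !avg_sum.
transitivity (\sum_(m : bmultinom n d.+1 | mdeg m == d)
    avg (fun w : W => meval (pt w) p * conjc (mono (pt w) m))).
  rewrite -avg_sum; apply: eq_avg => w.
  by rewrite /h /hsum rmorph_sum mulr_sumr.
apply: eq_bigr => m /eqP md; rewrite (avg_cst _ (card_root_gt0 n zetaP)).
transitivity (avg (fun w : W => \sum_(k : bmultinom n d.+1) (mcoeff k p *
    (mono z k * conjc (mono z m))) *
    (mono (root_pt zeta w) k * conjc (mono (root_pt zeta w) m)))).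
  apply: eq_avg => w; rewrite (meval_coef _ (msize_homog pd)) mulr_suml.
  apply: eq_bigr => k _; rewrite !monoM.
  have -> : conjc (mono z m * mono (root_pt zeta w) m) =
     conjc (mono z m) * conjc (mono (root_pt zeta w) m) by exact: rmorphM.
  by ring.
rewrite avg_sum (bigD1 m)//= avgZ (mono_orthogonal zetaP) ?md// eqxx mulr1.
rewrite conjc_unit ?mono_rnorm1// mulr1 big1 ?addr0// => k km.
rewrite avgZ (mono_orthogonal zetaP) ?md//; last exact: leq_trans (bmdeg k) _.
case: eqP => [e|]; last by rewrite mulr0.
by case/eqP: km; apply: val_inj.
Qed.

Definition power_sum_poly : mpoly n R[i] := (\sum_(i < n) mpolyX R[i] (mnm1 i)) ^+ d.

Lemma power_sum_homog : power_sum_poly \is is_homog d.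
Proof.
rewrite -[d]mul1n; apply: dhomogMn; apply: rpred_sum => i _.
by rewrite dhomogX /= mdeg1.
Qed.

Lemma meval_power_sum u : meval u power_sum_poly = (\sum_i u i) ^+ d.
Proof.
rewrite rmorphXn raddf_sum; congr (_ ^+ _); apply: eq_bigr => i _ /=.
exact: mevalXU.
Qed.

Lemma avg_power_sum_hsum :
  avg (fun w : W => complex.Re (conjc (S w ^+ d) * h w)) = n%:R ^+ d.
Proof.
have := avg_meval_conj_hsum power_sum_homog.
rewrite meval_power_sum sumr_const card_ord => E.
transitivity (complex.Re (avg (fun w : W => meval (pt w) power_sum_poly * conjc (h w)))).
  rewrite Re_avg; apply: eq_avg => w /=; rewrite meval_power_sum -/(S w).
  by case: (S w ^+ d) (h w) => [a b] [c e] /=; ring.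
by rewrite E -!natrX Re_nat.
Qed.

Lemma avg_hsum_sqr : (0 < n)%N ->
  avg (fun w : W => rnorm (h w) ^+ 2) = 'C(n + d - 1, d)%:R.
Proof.
move=> n0; have := avg_meval_conj_hsum (dhomog_is_dhomog (hpoly R n d)).
rewrite meval_hpoly /hsum (eq_bigr (fun=> 1 : R[i])); last first.
  by move=> m _; rewrite /mono big1// => i _; rewrite expr1n.
rewrite sumr_const.
have -> : #|[pred m : bmultinom n d.+1 | mdeg m == d]| = 'C(n + d - 1, d).
  case: n n0 => // k _; rewrite card_mnm_homog; congr 'C(_, _); lia.
move=> E; transitivity (complex.Re (avg (fun w : W =>
    meval (pt w) (mpoly_of_dhomog (hpoly R n d)) * conjc (h w)))).
  rewrite Re_avg; apply: eq_avg => w /=; rewrite meval_hpoly -/(h w).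
  by rewrite rnorm_sqr; case: (h w) => a b /=; ring.
by rewrite E Re_nat.
Qed.

(** Cauchy-Schwarz bounds the left side by the mean square of [S ^+ d - d! h], and expanding the
    square gives the right side. *)
Lemma avg_dist_power_sum_hsum : (0 < n)%N ->
  `|d`!%:R * avg (fun w => rnorm (h w)) - avg (fun w => rnorm (S w) ^+ d)| ^+ 2 <=
  avg (fun w => rnorm (S w) ^+ (2 * d)) - 2 * d`!%:R * n%:R ^+ d
    + d`!%:R ^+ 2 * 'C(n + d - 1, d)%:R.
Proof.
move=> n0; have W0 := card_root_gt0 n zetaP.
pose g w := rnorm (S w ^+ d - (d`!%:R : R)%:C%C * h w).
have gle : `|d`!%:R * avg (fun w => rnorm (h w)) - avg (fun w => rnorm (S w) ^+ d)| <= avg g.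
  rewrite -avgZ -avgB; apply: le_trans (ler_norm_avg _) _; apply: avg_le => w.
  have hE : d`!%:R * rnorm (h w) = rnorm ((d`!%:R : R)%:C%C * h w).
    by rewrite rnormM rnorm_real normr_nat.
  rewrite hE -rnormX ler_norml; apply/andP; split; last first.
    rewrite lerBlDr /g -(rnormN (_ - _)) opprB.
    by rewrite -[X in rnorm X <= _](subrK (S w ^+ d)) rnormD_le.
  rewrite lerNl opprB lerBlDr /g.
  by rewrite -[X in rnorm X <= _](subrK ((d`!%:R : R)%:C%C * h w)) rnormD_le.
apply: (@le_trans _ _ (avg g ^+ 2)).
  by rewrite lerXn2r ?nnegrE// avg_ge0// => w; exact: rnorm_ge0.
apply: (@le_trans _ _ (avg (fun w => g w ^+ 2))).
  have := avg_cauchy_schwarz g (fun=> 1).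
  rewrite (eq_avg (fun w => mulr1 (g w))) [X in _ <= _ * X](@eq_avg _ _ _ (fun=> 1)).
    by rewrite (avg_cst _ W0) mulr1.
  by move=> w; rewrite expr1n.
rewrite -avg_power_sum_hsum -(avg_hsum_sqr n0) -!avgZ -avgB -avgD.
rewrite le_eqVlt; apply/orP; left; apply/eqP; apply: eq_avg => w.
rewrite /g rnormD_sqr rnormN rnormM rnorm_real normr_nat rnormX.
have -> : complex.Re (conjc (S w ^+ d) * - ((d`!%:R : R)%:C%C * h w)) =
    - d`!%:R * complex.Re (conjc (S w ^+ d) * h w).
  by case: (conjc (S w ^+ d)) (h w) => [a b] [c e] /=; ring.
rewrite -exprM mulnC; ring.
Qed.
End PowerSumComparison.

(** * Passage to the limit *)

Section Limit.
Variables (R : realType) (d : nat).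
Local Notation G q := (Gamma (1 + q%:R / 2 : R)).

Lemma Gamma_moments_tend q : moment_tends (fun q => G q) q.
Proof.
apply: all_moments_tend.
- exact: Gamma_half0.
- exact: Gamma_half1_gt0.
- exact: Gamma_half_rec.
- exact: Gamma_half_log_convex.
Qed.

Lemma Gamma_half_even k : G (2 * k)%N = k`!%:R.
Proof.
elim: k => [|k IH]; first by rewrite muln0 Gamma_half0.
rewrite mulnS Gamma_half_rec IH factS [in RHS]natrM; congr (_ * _).
by rewrite natrM -natr1; field.
Qed.

(** The threshold [n0] precedes [N], [zeta] and [z]: the upper bound ranges over all rotations, and
    the lower bound chooses its own order of roots. *)
Lemma hsum_avg_tends (eps : R) : 0 < eps -> exists n0, forall n, (n0 <= n)%N ->
  forall (N : nat) (zeta : R[i]) (z : 'I_n -> R[i]),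
    N.-primitive_root zeta -> (d + 2 < N)%N -> (forall i, rnorm (z i) = 1) ->
  `|avg (fun w : {ffun 'I_n -> 'I_N} => rnorm (hsum d (fun i => z i * root_pt zeta w i)))
      / Num.sqrt n%:R ^+ d - G d / d`!%:R| <= eps.
Proof.
move=> eps0; set f : R := d`!%:R.
have f1 : 1 <= f by rewrite ler1n fact_gt0.
pose e := eps / 2; have e0 : 0 < e by rewrite divr_gt0.
(* Divided by [n ^+ d], the terms of the mean-square bound are at most [f + e1], [- 2 * f] and
   [f * (1 + e1)]; they add up to [(1 + f) * e1], that is [e ^+ 2]. *)
pose e1 := e ^+ 2 / (1 + f).
have e10 : 0 < e1 by rewrite divr_gt0 ?exprn_gt0//; lra.
have [s1 s11 H1] := Gamma_moments_tend d e0.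
have [s2 s21 H2] := Gamma_moments_tend (2 * d) e10.
have /cvgrPdist_le/(_ _ e10)[n1 _ Hn1] := @binomial_ratio_cvg R d.
exists (maxn n1 (Num.truncn ((s1 + s2) ^+ 2)).+1) => n.
rewrite geq_max => /andP[n1n sn] N zeta z zetaP dN z1.
have n0 : (0 < n)%N by exact: leq_trans sn.
set s := Num.sqrt n%:R.
have s_sqr : s ^+ 2 = n%:R by rewrite sqr_sqrtr.
have s12 : s1 + s2 <= s.
  rewrite -ler_sqr ?nnegrE ?sqrtr_ge0//; last lra.
  rewrite s_sqr; apply: le_trans (ltW (truncnS_gt _)) _.
  by rewrite ler_nat.
have N2 : (2 < N)%N by lia.
have dN' : (d < N)%N by lia.
have [r [t walk]] := steinhaus_walk zetaP z1 N2.
have := H1 _ _ _ _ _ _ walk (_ : s1 <= s) s_sqr.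
have := H2 _ _ _ _ _ _ walk (_ : s2 <= s) s_sqr.
have -> : s1 <= s by lra.
have -> : s2 <= s by lra.
move=> /(_ isT) M2 /(_ isT) M1.
have := avg_dist_power_sum_hsum zetaP dN' z1 n0.
set x := avg (fun w => rnorm (hsum _ _)).
set y := avg (fun w => rnorm _ ^+ d); set y2 := avg (fun w => rnorm _ ^+ (2 * d)).
rewrite -/f => L2.
have sgt0 : 0 < s by rewrite sqrtr_gt0 ltr0n.
have sd0 : 0 < s ^+ d by rewrite exprn_gt0.
have avgE (F : {ffun 'I_n -> 'I_N} -> R) k :
    avg (fun w => (F w / s) ^+ k) = avg (fun w => F w ^+ k) / s ^+ k.
  by rewrite mulrC -avgZ; apply: eq_avg => w; rewrite exprMn exprVn mulrC.
rewrite avgE -/y2 Gamma_half_even -/f in M2.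
rewrite avgE -/y in M1.
have nd : n%:R ^+ d = (s ^+ d) ^+ 2 by rewrite -s_sqr exprAC.
have sE : s ^+ (2 * d) = (s ^+ d) ^+ 2 by rewrite mulnC exprM.
have M3 := Hn1 n n1n; rewrite /= -/f nd in M3.
rewrite sE in M2; rewrite nd in L2.
set C : R := 'C(_, _)%:R in L2 M3.
set u := s ^+ d in sd0 M1 M2 M3 L2 *.
have u2 : 0 < u ^+ 2 by rewrite exprn_gt0.
have close : `|f * x / u - y / u| <= e.
  rewrite -ler_sqr ?nnegrE ?(ltW e0)// -mulrBl normrM normfV (gtr0_norm sd0).
  rewrite expr_div_n ler_pdivrMr//; apply: le_trans L2 _.
  have h2 : y2 / u ^+ 2 <= f + e1 by move: M2; rewrite ler_norml; lra.
  have h3 : f * C / u ^+ 2 <= 1 + e1 by move: M3; rewrite ler_norml; lra.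
  rewrite ler_pdivrMr// in h2; rewrite ler_pdivrMr// in h3.
  have -> : e ^+ 2 = (1 + f) * e1 by rewrite /e1; field; lra.
  have := ler_wpM2l (_ : 0 <= f) h3; rewrite (le_trans ler01 f1) => /(_ isT).
  lra.
have fx : `|f * x / u - G d| <= eps.
  have -> : eps = e + e by rewrite /e; field.
  rewrite (_ : _ - _ = (f * x / u - y / u) + (y / u - G d)); last by ring.
  by rewrite (le_trans (ler_normD _ _))// lerD.
have f0 : 0 < f by lra.
rewrite (_ : _ - _ = f^-1 * (f * x / u - G d)); last first.
  by field; rewrite !gt_eqF.
rewrite normrM gtr0_norm ?invr_gt0// ler_pdivrMl//.
by rewrite (le_trans fx)// ler_peMl// ltW.
Qed.

Lemma projection_constant_homog_poly_tends (eps : R) : 0 < eps ->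
  exists n0, forall n, (n0 <= n)%N ->
  exists2 l : R, projection_constant (homog_poly R n d) = l%:E &
    `|l / Num.sqrt n%:R ^+ d - G d / d`!%:R| <= eps.
Proof.
move=> eps0; have e0 : 0 < eps / 2 by rewrite divr_gt0.
have [n0 Hn0] := hsum_avg_tends e0.
exists (maxn n0 1) => n; rewrite geq_max => /andP[n0n n_gt0].
set u : R := Num.sqrt n%:R ^+ d; set g := G d / _.
have u0 : 0 < u by rewrite exprn_gt0// sqrtr_gt0 ltr0n.
have [|zeta zetaP] := @prim_root_exists R (d + 3)%N; first by lia.
have up : (projection_constant (homog_poly R n d) <= ((g + eps / 2) * u)%:E)%E.
  apply: (projection_constant_le zetaP); first lia.
  move=> v v1; have := Hn0 n n0n _ _ _ zetaP (_ : (d + 2 < d + 3)%N) v1.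
  rewrite ltn_add2l => /(_ isT); rewrite -/u -/g => H.
  by rewrite -ler_pdivrMr//; move: H; rewrite ler_norml; lra.
have lo : (((g - eps) * u)%:E <= projection_constant (homog_poly R n d))%E.
  have eu : 0 < eps / 2 * u by rewrite mulr_gt0.
  have [N [zeta' [zP dN] H]] := exists_sampled_lower_bound d n_gt0 eu.
  apply: le_trans H; rewrite lee_fin.
  have one1 : rnorm (1 : R[i]) = 1 by rewrite rnorm_real normr1.
  have := Hn0 n n0n _ _ (fun=> 1) zP dN (fun=> one1).
  rewrite -/u -/g.
  have -> : (fun w : {ffun 'I_n -> 'I_N} => rnorm (hsum d (fun i => 1 * root_pt zeta' w i)))
    = (fun w => rnorm (hsum d (root_pt zeta' w))).
    by apply/funext => w; congr (rnorm (hsum d _)); apply/funext => i; rewrite mul1r.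
  by move=> H; exact: le_of_ratio_dist.
(* The two finite bounds exclude infinite values. *)
case E : (projection_constant _) up lo => [l| |].
- rewrite !lee_fin => up lo; exists l => //.
  rewrite -ler_pdivlMr// in lo; rewrite -ler_pdivrMr// in up.
  exact: dist_le_of_bounds.
- by rewrite leye_eq.
- by rewrite leeNy_eq.
Qed.
End Limit.

Lemma cvg_ereal_ratio (R : realType) (u : nat -> \bar R) (c l : nat -> R) (a : R) :
  (\forall n \near \oo, u n = (l n)%:E /\ c n != 0) ->
  (fun n => l n / c n) @ \oo --> a ->
  (u n / (c n)%:E)%E @[n --> \oo] --> a%:E.
Proof.
move=> near_u cvg_l.
have H : (l n / c n)%:E @[n --> \oo] --> a%:E by apply: cvg_EFin; [exact: nearW | exact: cvg_l].
apply: cvg_trans H; apply: near_eq_cvg; apply: filterS near_u => n [-> c0].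
by rewrite inver (negPf c0) EFinM.
Qed.

Theorem theorem2p1 (R : realType) (d : nat) (d_gt0 : (0 < d)%N) :
  ((projection_constant (homog_poly R n d) /
      (Num.sqrt ('C(n + d - 1, d)%:R : R))%:E)%E @[n --> \oo] -->
    (Gamma (1 + d%:R / 2%:R : R) / Num.sqrt (d`!%:R : R))%:E)
  /\
  ((projection_constant (homog_poly R n d) /
      ((n%:R : R) `^ (d%:R / 2%:R))%:E)%E @[n --> \oo] -->
    (Gamma (1 + d%:R / 2%:R : R) / d`!%:R)%:E).
Proof.
pose l n := fine (projection_constant (homog_poly R n d)).
pose s n : R := Num.sqrt n%:R ^+ d.
set g : R := Gamma _.
have near_l : \forall n \near \oo, projection_constant (homog_poly R n d) = (l n)%:E.
  have [n0 Hn0] := @projection_constant_homog_poly_tends R d _ (ltr01 : 0 < 1 :> R).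
  by exists n0 => // n n0n; have [x E _] := Hn0 n n0n; rewrite /l E.
have cvg_l : (fun n => l n / s n) @ \oo --> g / d`!%:R.
  apply/cvgrPdist_le => /= e e0.
  have [n0 Hn0] := @projection_constant_homog_poly_tends R d _ e0.
  by exists n0 => // n n0n; have [x E ?] := Hn0 n n0n; rewrite /l E distrC.
have near_pos : \forall n \near \oo, (0 < n)%N by exists 1%N.
have f0 : 0 < d`!%:R :> R by rewrite ltr0n fact_gt0.
have s0 n : (0 < n)%N -> 0 < s n by move=> n0; rewrite exprn_gt0// sqrtr_gt0 ltr0n.
split; last first.
  apply: (cvg_ereal_ratio (l := l)).
    by apply: filterS2 near_l near_pos => n -> n0; split=> //; rewrite gt_eqF// powR_gt0// ltr0n.
  apply: cvg_trans cvg_l; apply: near_eq_cvg; apply: filterS near_pos => n n0.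
  congr (_ / _); rewrite /s -powR_mulrn ?sqrtr_ge0// -powR12_sqrt//.
  by rewrite -powRrM mulrC.
apply: (cvg_ereal_ratio (l := l)).
  apply: filterS2 near_l near_pos => n -> n0; split=> //.
  by rewrite gt_eqF// sqrtr_gt0 ltr0n bin_gt0; lia.
(* The first normalization follows from the second, since the square root of the binomial is
   asymptotic to n^(d/2) divided by the square root of d!. *)
have ratio : (fun n => Num.sqrt (d`!%:R * 'C(n + d - 1, d)%:R / n%:R ^+ d) : R) @ \oo --> (1 : R).
  rewrite -[X in _ --> X]sqrtr1.
  by apply: continuous_cvg; [exact: sqrt_continuous | exact: binomial_ratio_cvg].
have H : (fun n => (l n / s n) * (Num.sqrt (d`!%:R * 'C(n + d - 1, d)%:R / n%:R ^+ d))^-1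
   * Num.sqrt d`!%:R) @ \oo --> g / d`!%:R * 1^-1 * Num.sqrt d`!%:R.
  apply: cvgM; last exact: cvg_cst.
  apply: cvgM; first exact: cvg_l.
  by apply: cvgV => //; rewrite oner_neq0.
have sq0 : Num.sqrt d`!%:R != 0 :> R by rewrite gt_eqF// sqrtr_gt0.
have -> : g / Num.sqrt d`!%:R = g / d`!%:R * 1^-1 * Num.sqrt d`!%:R.
  rewrite -{2}(@sqr_sqrtr _ d`!%:R) ?(ltW f0)//; field.
  exact: sq0.
apply: cvg_trans H; apply: near_eq_cvg; apply: filterS near_pos => n n0.
rewrite sqrtrM ?mulr_ge0 ?ler0n// sqrtrV ?exprn_ge0// sqrtrM ?(ltW f0)//.
have -> : Num.sqrt (n%:R ^+ d) = s n.
  by rewrite -[n%:R in LHS](@sqr_sqrtr R) ?ler0n// -exprM mulnC exprM sqrtr_sqr ger0_norm// ltW// s0.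
have C0 : Num.sqrt ('C(n + d - 1, d)%:R) != 0 :> R.
  by rewrite gt_eqF// sqrtr_gt0 ltr0n bin_gt0; lia.
by field; rewrite sq0 C0 gt_eqF// s0.
Qed.
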